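(* Let $X\subset\mathbb R^m$ be compact with finite intrinsic distance $d_X$ on $X\times X$, let $S_n\subseteq X$ be a finite subset, let $f\colon X\to\mathbb R$ be continuous with $(X,f)$ a constructible $\mathbb R$-space, let $\omega_f$ be a fixed non-decreasing modulus of continuity of $f$ with respect to $d_X$, and let $R=\mathfrak R(X,f)$. Assume that $X$ has positive reach $\tau=\mathrm{rch}(X)>0$, that $0<\delta<\tau$, and that $\delta$ is a Euclidean covering radius for $S_n$: for all $x\in X$ there is $s\in S_n$ with $\|x-s\|\le\delta$. Then $$d_I\bigl(\mathcal F_R,\mathcal R_\delta^{S_n,\|\cdot\|}\bigr)\le\omega_f(\eta_\tau(\delta)),\qquad \eta_\tau(\delta)=2\tau\arcsin\Bigl(\frac{\delta}{\tau}\Bigr).$$ In particular, if $f$ is $1$-Lipschitz with respect to $d_X$ and $2\delta<\tau$, then $$d_I\bigl(\mathcal F_R,\mathcal R_\delta^{S_n,\|\cdot\|}\bigr)\le\frac{2\pi}{3}\,\delta .$$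
   Context: **Intrinsic distance and reach.** $d_X(x,y)$ is the infimum of the lengths (suprema of Euclidean polygonal sums) of continuous paths in $X$ from $x$ to $y$ ($+\infty$ if there is no path). The reach $\mathrm{rch}(X)$ of a closed set $X\subset\mathbb R^m$ is the infimum of $\mathrm{dist}(z,X)$ over points $z$ of the medial axis, i.e. points of $\mathbb R^m$ having more than one closest point in $X$. **Constructible $\mathbb R$-spaces.** $(X,f)$, $f\colon X\to\mathbb R$ continuous, is constructible if it is isomorphic over $\mathbb R$ to a space built from finitely many reals $a_0<\dots<a_n$, compact locally path-connected spaces $V_0,\dots,V_n$, $E_0,\dots,E_{n-1}$ and continuous maps $l_i\colon E_i\to V_i$, $r_i\colon E_i\to V_{i+1}$ as the quotient of $\bigsqcup_i V_i\times\{a_i\}\sqcup\bigsqcup_iE_i\times[a_i,a_{i+1}]$ by $(x,a_i)\sim(l_i(x),a_i)$, $(x,a_{i+1})\sim(r_i(x),a_{i+1})$, with $f$ the second projection. The Reeb graph $\mathfrak R(X,f)=(X/\!\sim_f,\bar f)$ identifies points lying in the same path component of a level set of $f$. **Cosheaves and interleaving distance.** $\mathbf{Int}$ is the poset category of open intervals of $\mathbb R$. For an $\mathbb R$-space $(Y,g)$, $\mathcal F_{(Y,g)}(I)=\pi_0(g^{-1}(I))$, with maps induced by inclusion; $\mathcal F_R$ is this functor for the Reeb graph $R$, and it is canonically isomorphic to $\mathcal F_{(X,f)}$. For $I=(a,b)$ put $I^\varepsilon=(a-\varepsilon,b+\varepsilon)$ and $\mathcal S_\varepsilon(\mathcal G)(I)=\mathcal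 G(I^\varepsilon)$. An $\varepsilon$-interleaving of $\mathcal F,\mathcal G$ is a pair of natural transformations $\varphi\colon\mathcal F\Rightarrow\mathcal S_\varepsilon\mathcal G$, $\psi\colon\mathcal G\Rightarrow\mathcal S_\varepsilon\mathcal F$ such that $\mathcal S_\varepsilon(\psi)\circ\varphi$ and $\mathcal S_\varepsilon(\varphi)\circ\psi$ are the canonical transformations induced by $I\subseteq I^{2\varepsilon}$. $d_I(\mathcal F,\mathcal G)$ is the infimum of such $\varepsilon\ge0$. **Modulus.** $\omega_f\colon[0,\infty)\to[0,\infty)$ is non-decreasing with $\omega_f(0)=0$ and $|f(x)-f(y)|\le\omega_f(d_X(x,y))$ for all $x,y\in X$. **PL-Reeb estimator.** $\Gamma_\delta^{S_n,\|\cdot\|}$ is the graph with vertex set $S_n$ in which distinct $x,y$ are joined by an edge iff $\|x-y\|\le2\delta$. $\hat f_n^{\|\cdot\|}\colon|\Gamma_\delta^{S_n,\|\cdot\|}|\to\mathbb R$ is the extension of $f|_{S_n}$ to the geometric realization that is affine on each edge. $\mathcal R_\delta^{S_n,\|\cdot\|}$ is the functor $I\mapsto\pi_0\bigl((\hat f_n^{\|\cdot\|})^{-1}(I)\bigr)$. *)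

(* Defs.v *)
From HB Require Import structures.
From Stdlib Require Import Relation_Operators.
From mathcomp Require Import all_boot all_order all_algebra.
From mathcomp Require Import generic_quotient finmap lra.
From mathcomp Require Import all_classical all_reals all_analysis.

Set Implicit Arguments.
Unset Strict Implicit.
Unset Printing Implicit Defensive.

Import Order.TTheory GRing.Theory Num.Theory.
Import numFieldNormedType.Exports.

Local Open Scope classical_set_scope.
Local Open Scope ring_scope.
Local Open Scope quotient_scope.

Section Paths.
Context {R : realType} {T : topologicalType}.
Implicit Types (A B : set T) (x y z : T) (g : R -> T).

(* Only the restriction of [g] to [0, 1] matters. *)
Definition is_path A x y g : Prop :=
  [/\ {within `[0, 1], continuous g}, g 0 = x, g 1 = y &
      forall t, t \in `[0, 1] -> A (g t)].

Definition path_joined A x y : Prop := exists g, is_path A x y g.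

Lemma path_joined_mem A x y : path_joined A x y -> A x /\ A y.
Proof.
by case=> g [_ <- <- gA]; split; apply: gA; rewrite in_itv /= ?lexx ?ler01.
Qed.

Lemma path_joinedS A B x y : A `<=` B -> path_joined A x y -> path_joined B x y.
Proof. by move=> AB [g [? ? ? gA]]; exists g; split=> // t /gA /AB. Qed.

Lemma path_joined_refl A x : A x -> path_joined A x x.
Proof.
move=> Ax; exists (cst x); split=> //.
by apply: continuous_subspaceT => t; exact: cvg_cst.
Qed.

Lemma within_comp_affine (a b c d : R) g :
    (forall t, t \in `[a, b] -> c * t + d \in `[0, 1]) ->
    {within `[0, 1], continuous g} ->
  {within `[a, b], continuous (fun t => g (c * t + d))}.
Proof.
move=> hab /subspace_continuousP cg; apply/subspace_continuousP => x abx.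
move=> U /(cg _ (hab _ abx)) gU.
have cphi : {for x, continuous (fun t : R => c * t + d)}.
  by apply: cvgD; [apply: cvgM; [exact: cvg_cst|exact: cvg_id]|exact: cvg_cst].
have := cphi _ gU; rewrite !nbhs_simpl /=.
by rewrite /within /=; apply: filterS => t gt abt; exact/gt/hab.
Qed.

Lemma path_joined_sym A x y : path_joined A x y -> path_joined A y x.
Proof.
case=> g [cg g0 g1 gA].
have h t : t \in `[0, 1] -> -1 * t + 1 \in `[(0 : R), 1].
  by rewrite !in_itv /= mulN1r => /andP[t0 t1]; rewrite addrC subr_ge0 t1 gerBl.
exists (fun t => g (-1 * t + 1)); split.
- exact: within_comp_affine.
- by rewrite mulr0 add0r.
- by rewrite mulr1 addNr.
- by move=> t /h /gA.
Qed.

Lemma path_joined_trans A y x z :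
  path_joined A x y -> path_joined A y z -> path_joined A x z.
Proof.
case=> g [cg g0 g1 gA] [h [ch h0 h1 hA]].
have half0 : (0 : R) < 2^-1 by rewrite invr_gt0 ltr0n.
have half1 : (2^-1 : R) < 1 by rewrite invf_lt1 ?ltr1n ?ltr0n.
have e2 : 2 * 2^-1 = 1 :> R by rewrite divff.
have gi t : t \in `[0, 2^-1] -> 2 * t + 0 \in `[(0 : R), 1].
  by rewrite !in_itv /= => /andP[t0 t1]; apply/andP; split; lra.
have hi t : t \in `[2^-1, 1] -> 2 * t + -1 \in `[(0 : R), 1].
  by rewrite !in_itv /= => /andP[t0 t1]; apply/andP; split; lra.
pose k t : T := if t <= 2^-1 then g (2 * t + 0) else h (2 * t + -1).
have kE t : t <= 2^-1 -> g (2 * t + 0) = k t by rewrite /k => ->.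
have kE' t : 2^-1 <= t -> h (2 * t + -1) = k t.
  move=> t0; rewrite /k; case: ifPn => // t1.
  have -> : t = 2^-1 by apply/eqP; rewrite eq_le t0 t1.
  by rewrite e2 subrr addr0 g1 h0.
exists k; split.
- have -> : `[(0 : R), 1]%classic = `[0, 2^-1] `|` `[2^-1, 1].
    apply/seteqP; split=> t /=; rewrite !in_itv /=.
      case/andP=> -> ->; have [?|/ltW ->] := leP t 2^-1; first by left.
      by right.
    by case=> /andP[t0 t1]; rewrite ?(le_trans t1 (ltW half1)) ?t0 ?t1
      ?(le_trans (ltW half0) t0).
  apply: withinU_continuous; try exact: interval_closed.
    apply: (@subspace_eq_continuous R `[0, 2^-1] T (fun t => g (2 * t + 0))).
      by move=> t /set_mem; rewrite /= in_itv /= => /andP[_ /kE].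
    exact: (within_comp_affine gi cg).
  apply: (@subspace_eq_continuous R `[2^-1, 1] T (fun t => h (2 * t + -1))).
    by move=> t /set_mem; rewrite /= in_itv /= => /andP[/kE' ->].
  exact: (within_comp_affine hi ch).
- by rewrite /k (ltW half0) mulr0 addr0.
- by rewrite /k leNgt half1 /= mulr1 addrK.
- move=> t; rewrite in_itv /= => /andP[t0 t1]; rewrite /k.
  case: (leP t 2^-1) => t2; [apply/gA/gi|apply/hA/hi]; rewrite in_itv /=.
    by rewrite t0 t2.
  by rewrite (ltW t2) t1.
Qed.

End Paths.

Section PathConnected.
Context (R : realType).

Definition path_connected (T : topologicalType) (A : set T) : Prop :=
  A !=set0 /\ forall x y, A x -> A y -> @path_joined R T A x y.

Definition locally_path_connected (T : topologicalType) : Prop :=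
  forall (x : T) (U : set T), nbhs x U ->
    exists V : set T, [/\ open V, V x, V `<=` U & path_connected V].

End PathConnected.

Section Pi0.
Context (R : realType) {T : topologicalType}.
Implicit Types A B C : set T.

Definition same_component A : rel A :=
  fun x y => `[< @path_joined R T A (\val x) (\val y) >].

Lemma same_component_refl A : reflexive (@same_component A).
Proof. by move=> x; apply/asboolP/path_joined_refl/set_valP. Qed.

Lemma same_component_sym A : symmetric (@same_component A).
Proof. by move=> x y; apply/asboolP/asboolP; exact: path_joined_sym. Qed.

Lemma same_component_trans A : transitive (@same_component A).
Proof.
move=> y x z /asboolP xy /asboolP yz; apply/asboolP.
exact: path_joined_trans xy yz.
Qed.

Definition component_equiv A :=
  EquivRel (@same_component A) (@same_component_refl A)
    (@same_component_sym A) (@same_component_trans A).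

Definition pi0 A : Type := {eq_quot (component_equiv A)}.

Definition pi0_class A (x : A) : pi0 A := \pi_{eq_quot (component_equiv A)} x.

Definition pi0_repr A (c : pi0 A) : A :=
  repr (c : {eq_quot (component_equiv A)}).

Lemma pi0_reprK A : cancel (@pi0_repr A) (@pi0_class A).
Proof. exact: reprK. Qed.

Lemma pi0_classP A (x y : A) :
  pi0_class x = pi0_class y <-> @path_joined R T A (\val x) (\val y).
Proof.
by split=> [/eqmodP /asboolP //|xy]; exact/eqmodP/asboolP.
Qed.

Definition pi0_incl A B (AB : A `<=` B) (c : pi0 A) : pi0 B :=
  pi0_class (subfun AB (pi0_repr c)).

Lemma pi0_incl_class A B (AB : A `<=` B) (x : A) :
  pi0_incl AB (pi0_class x) = pi0_class (subfun AB x).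
Proof.
apply/pi0_classP; apply: (path_joinedS AB).
by apply/(pi0_classP (pi0_repr (pi0_class x)) x); rewrite pi0_reprK.
Qed.

Lemma pi0_incl_id A (AA : A `<=` A) (c : pi0 A) : pi0_incl AA c = c.
Proof.
rewrite -[RHS](pi0_reprK c); apply/pi0_classP.
exact/path_joined_refl/set_valP.
Qed.

Lemma pi0_incl_comp A B C (AB : A `<=` B) (BC : B `<=` C) (AC : A `<=` C)
    (c : pi0 A) : pi0_incl AC c = pi0_incl BC (pi0_incl AB c).
Proof.
rewrite [pi0_incl AB c]/pi0_incl pi0_incl_class; apply/pi0_classP.
exact/path_joined_refl/set_valP.
Qed.

End Pi0.

Record rspace (R : realType) := RSpace {
  rspace_sort :> topologicalType;
  height : rspace_sort -> R;
  height_continuous : continuous height }.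

Definition rspace_iso (R : realType) (Y Z : rspace R) : Prop :=
  exists (h : Y -> Z) (k : Z -> Y),
    [/\ continuous h, continuous k, cancel h k, cancel k h &
        forall y, height (h y) = height y].

Record constructible_data (R : realType) := ConstructibleData {
  cd_n : nat;
  cd_a : 'I_cd_n.+1 -> R;
  cd_V : 'I_cd_n.+1 -> topologicalType;
  cd_E : 'I_cd_n -> topologicalType;
  cd_l : forall i, cd_E i -> cd_V (widen_ord (leqnSn cd_n) i);
  cd_r : forall i, cd_E i -> cd_V (lift ord0 i);
  cd_a_incr : forall i j : 'I_cd_n.+1, (i < j)%N -> cd_a i < cd_a j;
  cd_V_compact : forall i, compact [set: cd_V i];
  cd_V_lpc : forall i, locally_path_connected R (cd_V i);
  cd_E_compact : forall i, compact [set: cd_E i];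
  cd_E_lpc : forall i, locally_path_connected R (cd_E i);
  cd_l_continuous : forall i, continuous (@cd_l i);
  cd_r_continuous : forall i, continuous (@cd_r i) }.

Section Glued.
Context (R : realType) (D : constructible_data R).
Local Notation n := (cd_n D).
Local Notation a := (@cd_a R D).

Definition lower (i : 'I_n) : 'I_n.+1 := widen_ord (leqnSn n) i.
Definition upper (i : 'I_n) : 'I_n.+1 := lift ord0 i.

(* The index [inl i] stands for V_i x {a_i}, and [inr i] for
   E_i x [a_i, a_{i+1}]. *)
Definition piece (j : 'I_n.+1 + 'I_n) : topologicalType :=
  match j with
  | inl i => (cd_V i * [set a i])%type
  | inr i => (cd_E i * `[a (lower i), a (upper i)]%classic)%type
  end.

Definition pieces : topologicalType := {j & piece j}.

Definition piece_height (j : 'I_n.+1 + 'I_n) : piece j -> R :=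
  match j with
  | inl i => fun p => \val p.2
  | inr i => fun p => \val p.2
  end.

Definition pieces_height (p : pieces) : R := piece_height (projT2 p).

Definition vertex_point (i : 'I_n.+1) (x : cd_V i) : pieces :=
  existT piece (inl i) (x, SigSub (mem_set (erefl (a i)))).

Definition edge_point (i : 'I_n) (x : cd_E i)
    (t : `[a (lower i), a (upper i)]%classic) : pieces :=
  existT piece (inr i) (x, t).

Inductive glue : pieces -> pieces -> Prop :=
| glue_lower i x t : \val t = a (lower i) ->
    glue (@edge_point i x t) (@vertex_point (lower i) (cd_l x))
| glue_upper i x t : \val t = a (upper i) ->
    glue (@edge_point i x t) (@vertex_point (upper i) (cd_r x)).

Definition glued_rel : rel pieces :=
  fun p q => `[< clos_refl_sym_trans pieces glue p q >].

Lemma glued_rel_refl : reflexive glued_rel.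
Proof. by move=> p; apply/asboolP; exact: rst_refl. Qed.

Lemma glued_rel_sym : symmetric glued_rel.
Proof. by move=> p q; apply/asboolP/asboolP; exact: rst_sym. Qed.

Lemma glued_rel_trans : transitive glued_rel.
Proof.
by move=> q p r /asboolP pq /asboolP qr; apply/asboolP; exact: rst_trans pq qr.
Qed.

Definition glued_equiv :=
  EquivRel glued_rel glued_rel_refl glued_rel_sym glued_rel_trans.

Lemma glued_rel_height p q : glued_rel p q -> pieces_height p = pieces_height q.
Proof. by move/asboolP; elim=> // [_ _ []//|? ? ? _ -> _ ->]. Qed.

Lemma pieces_height_continuous : continuous pieces_height.
Proof.
have sub (A : set R) : continuous (\val : A -> R) by exact: initial_continuous.
have snd_cont (U : topologicalType) (A : set R) :
    continuous (fun p : U * A => \val p.2).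
  move=> p; apply: (@continuous_comp (U * A)%type A R snd val).
    exact: cvg_snd.
  exact: sub.
by case=> -[i|i] p U pU; exact: (snd_cont _ _ p _ pU).
Qed.

Definition glued_space : topologicalType :=
  quotient_topology {eq_quot glued_equiv}.

Definition glued_height (q : glued_space) : R :=
  pieces_height (repr (q : {eq_quot glued_equiv})).

Lemma glued_height_continuous : continuous glued_height.
Proof.
apply: (repr_comp_continuous pieces_height_continuous) => p q /eqP.
by move/(eqmodP glued_equiv)/glued_rel_height/eqP.
Qed.

Definition glued : rspace R := RSpace glued_height_continuous.

End Glued.

Definition constructible (R : realType) (Y : rspace R) : Prop :=
  exists D : constructible_data R, rspace_iso Y (glued D).

Section Reeb.
Context (R : realType) (Y : rspace R).

Definition reeb_rel : rel Y := fun x y =>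
  `[< @path_joined R Y (@height R Y @^-1` [set height x]) x y >].

Lemma reeb_rel_height x y : reeb_rel x y -> height x = height y.
Proof. by move=> /asboolP xy; have [_ /= ->] := path_joined_mem xy. Qed.

Lemma reeb_rel_refl : reflexive reeb_rel.
Proof. by move=> x; apply/asboolP/path_joined_refl. Qed.

Lemma reeb_rel_sym : symmetric reeb_rel.
Proof.
move=> x y; apply/idP/idP => xy; have := reeb_rel_height xy;
  move: xy => /asboolP xy e; apply/asboolP.
- by rewrite -e; exact: path_joined_sym.
- by rewrite -e; exact: path_joined_sym.
Qed.

Lemma reeb_rel_trans : transitive reeb_rel.
Proof.
move=> y x z xy; have e := reeb_rel_height xy.
move: xy => /asboolP xy /asboolP; rewrite -e => yz; apply/asboolP.
exact: path_joined_trans xy yz.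
Qed.

Definition reeb_equiv := EquivRel reeb_rel reeb_rel_refl reeb_rel_sym reeb_rel_trans.

Definition reeb_space : topologicalType := quotient_topology {eq_quot reeb_equiv}.

Definition reeb_height (c : reeb_space) : R :=
  height (repr (c : {eq_quot reeb_equiv})).

Lemma reeb_height_continuous : continuous reeb_height.
Proof.
apply: (repr_comp_continuous (@height_continuous R Y)) => x y /eqP.
by move/(eqmodP reeb_equiv)/reeb_rel_height/eqP.
Qed.

Definition reeb_graph : rspace R := RSpace reeb_height_continuous.

End Reeb.

Section Intervals.
Context {R : realType}.

(* Nonempty open intervals, bounded or not. *)
Record oint := OInt {
  lo : \bar R;
  hi : \bar R;
  lo_lt_hi : (lo < hi)%E }.

Definition oint_set (I : oint) : set R :=
  [set t | (lo I < t%:E)%E /\ (t%:E < hi I)%E].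

Lemma ereal_between (a b : \bar R) :
  (a < b)%E -> exists t : R, (a < t%:E)%E /\ (t%:E < b)%E.
Proof.
case: a b => [a| |] [b| |] //=; rewrite ?lte_fin => ab.
- by exists ((a + b) / 2); rewrite !lte_fin; split; lra.
- by exists (a + 1); rewrite lte_fin ltrDl ltr01 ltry.
- by exists (b - 1); rewrite lte_fin ltNyr; split=> //; lra.
- by exists 0; rewrite ltNyr ltry.
Qed.

Lemma oint_subsetP (I J : oint) :
  oint_set I `<=` oint_set J <-> (lo J <= lo I)%E /\ (hi I <= hi J)%E.
Proof.
split=> [IJ|[loJI hiIJ] t /= [lot thi]]; last first.
  by split; [exact: le_lt_trans lot | exact: lt_le_trans hiIJ].
split; rewrite leNgt; apply/negP => h.
- have [t [It]] : exists t, (lo I < t%:E)%E /\ (t%:E < mine (lo J) (hi I))%E.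
    by apply: ereal_between; rewrite lt_min h lo_lt_hi.
  rewrite lt_min => /andP[tJ tI]; have [/= Jt _] := IJ t (conj It tI).
  by move: (lt_trans Jt tJ); rewrite ltxx.
- have [t [+ tI]] : exists t, (maxe (hi J) (lo I) < t%:E)%E /\ (t%:E < hi I)%E.
    by apply: ereal_between; rewrite gt_max h lo_lt_hi.
  rewrite gt_max => /andP[Jt It]; have [_ /= tJ] := IJ t (conj It tI).
  by move: (lt_trans Jt tJ); rewrite ltxx.
Qed.

Section Thicken.
Variable eps : {nonneg R}.

Fact thicken_proof (I : oint) : (lo I - eps%:num%:E < hi I + eps%:num%:E)%E.
Proof.
apply: (@le_lt_trans _ _ (lo I)); first by rewrite geeDl // leeNl oppe0 lee_fin.
by apply: (lt_le_trans (lo_lt_hi I)); rewrite leeDl // lee_fin.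
Qed.

Definition thicken (I : oint) : oint := OInt (thicken_proof I).

Lemma sub_thicken I : oint_set I `<=` oint_set (thicken I).
Proof.
apply/oint_subsetP; split=> /=; last by rewrite leeDl // lee_fin.
by rewrite geeDl // leeNl oppe0 lee_fin.
Qed.

Lemma thickenS I J :
  oint_set I `<=` oint_set J -> oint_set (thicken I) `<=` oint_set (thicken J).
Proof.
by move=> /oint_subsetP[loJI hiIJ]; apply/oint_subsetP; split=> /=; exact: leeD.
Qed.

End Thicken.

End Intervals.

Arguments oint R : clear implicits.
Arguments sub_thicken {R} eps I _ _.
Arguments thickenS {R} eps {I J} _ _ _.

Section Cosheaves.
Context {R : realType}.

Record precosheaf := Precosheaf {
  cs_ob :> oint R -> Type;
  cs_map : forall I J, oint_set I `<=` oint_set J -> cs_ob I -> cs_ob J;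
  cs_map_id : forall I (II : oint_set I `<=` oint_set I) x, cs_map II x = x;
  cs_map_comp : forall I J K (IJ : oint_set I `<=` oint_set J)
    (JK : oint_set J `<=` oint_set K) (IK : oint_set I `<=` oint_set K) x,
    cs_map IK x = cs_map JK (cs_map IJ x) }.

Definition shift (eps : {nonneg R}) (F : precosheaf) : precosheaf :=
  @Precosheaf (fun I => F (thicken eps I))
    (fun I J IJ => @cs_map F _ _ (thickenS eps IJ))
    (fun I II => @cs_map_id F _ _)
    (fun I J K IJ JK IK => @cs_map_comp F _ _ _ _ _ _).

Definition natural (F G : precosheaf) (phi : forall I, F I -> G I) : Prop :=
  forall I J (IJ : oint_set I `<=` oint_set J) x,
    phi J (cs_map IJ x) = cs_map IJ (phi I x).

(* The composites land in [F ((I^eps)^eps)], and (I^eps)^eps = I^(2 eps). *)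
Definition interleaved (eps : {nonneg R}) (F G : precosheaf) : Prop :=
  exists (phi : forall I, F I -> shift eps G I)
         (psi : forall I, G I -> shift eps F I),
    [/\ natural phi, natural psi,
        forall I x, psi (thicken eps I) (phi I x) =
          cs_map (subset_trans (sub_thicken eps I) (sub_thicken eps _)) x &
        forall I x, phi (thicken eps I) (psi I x) =
          cs_map (subset_trans (sub_thicken eps I) (sub_thicken eps _)) x].

Definition interleaving_dist (F G : precosheaf) : \bar R :=
  ereal_inf [set eps%:num%:E | eps in [set eps : {nonneg R} | interleaved eps F G]].

Definition preimage_oint (Y : rspace R) (I : oint R) : set Y :=
  @height R Y @^-1` oint_set I.
Arguments preimage_oint : clear implicits.

Definition pi0_cosheaf (Y : rspace R) : precosheaf :=
  @Precosheaf (fun I => pi0 R (preimage_oint Y I))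
    (fun I J IJ => pi0_incl (preimage_subset IJ))
    (fun I II => @pi0_incl_id _ _ _ _)
    (fun I J K IJ JK IK => @pi0_incl_comp _ _ _ _ _ _ _ _).

End Cosheaves.

Section Euclidean.
Context {R : realType} {m : nat}.
Implicit Types (X : set 'rV[R]_m) (x y z : 'rV[R]_m).

(* The library norm of ['rV[R]_m] is the sup norm; the topology is the same. *)
Definition enorm x : R := Num.sqrt (\sum_(i < m) x ord0 i ^+ 2).

Definition polygonal_sum (g : R -> 'rV[R]_m) (s : seq R) : R :=
  \sum_(0 <= i < size s) enorm (g (nth 1 (0 :: s) i.+1) - g (nth 1 (0 :: s) i)).

Definition path_length (g : R -> 'rV[R]_m) : \bar R :=
  ereal_sup [set (polygonal_sum g s)%:E | s in itv_partition 0 1].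

Definition intrinsic_dist X x y : \bar R :=
  ereal_inf [set path_length g | g in is_path X x y].

Definition dist_to X z : \bar R := ereal_inf [set (enorm (z - x))%:E | x in X].

Definition closest_point X z x : Prop := X x /\ (enorm (z - x))%:E = dist_to X z.

Definition medial_axis X : set 'rV[R]_m :=
  [set z | exists x y, [/\ x <> y, closest_point X z x & closest_point X z y]].

Definition reach X : \bar R := ereal_inf [set dist_to X z | z in medial_axis X].

End Euclidean.

Section GeometricRealization.
Context (R : realType) (V : finType) (e : rel V) (h : V -> R).

(* Barycentric coordinates [t] on the vertices, supported by a vertex or by an
   edge; as [V] is finite, the CW topology is that of pointwise convergence. *)
Definition realization : set {ptws V -> R} :=
  [set t | [/\ forall v, 0 <= t v, \sum_v t v = 1 &
     exists u v, (u = v \/ e u v) /\ forall w, t w != 0 -> w = u \/ w = v]].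

Definition affine_extension (t : realization) : R := \sum_v \val t v * h v.

Lemma affine_extension_continuous : continuous affine_extension.
Proof.
have cval : continuous (\val : realization -> {ptws V -> R}).
  exact: initial_continuous.
have cproj (v : V) : continuous (fun t : {ptws V -> R} => t v).
  exact: (@proj_continuous V (fun=> R) v).
apply: (@continuous_big R V +%R 0 xpredT) => [|v _ t]; first exact: add_continuous.
apply: (@cvgM R realization (nbhs t)); last exact: cvg_cst.
exact: (continuous_comp (cval t) (cproj v _)).
Qed.

Definition pl_space : rspace R := RSpace affine_extension_continuous.

End GeometricRealization.

Section Estimator.
Context (R : realType) (m : nat) (X : set 'rV[R]_m).

Definition neighborhood_graph (S : {fset X}) (delta : R) : rel S :=
  fun x y => (x != y) && (enorm (\val (\val x) - \val (\val y)) <= 2 * delta).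

Definition pl_reeb_estimator (S : {fset X}) (f : X -> R) (delta : R) :
    precosheaf :=
  pi0_cosheaf (pl_space (@neighborhood_graph S delta) (fun s => f (\val s))).

End Estimator.

Section Modulus.
Context (R : realType) (m : nat) (X : set 'rV[R]_m).

(* [w] matters on [0, +oo[ only, where it is nonnegative by the first two
   conditions. *)
Definition modulus_of_continuity (f : X -> R) (w : R -> R) : Prop :=
  [/\ w 0 = 0, forall r s, 0 <= r -> r <= s -> w r <= w s &
      forall x y : X, `|f x - f y| <= w (fine (intrinsic_dist X (\val x) (\val y)))].

End Modulus.

(* An infinite reach (X convex) is given the limit of 2 t asin (d / t) as t
   tends to +oo. The value at -oo is never used. *)
Definition reach_eta (R : realType) (tau : \bar R) (d : R) : R :=
  match tau with
  | t%:E => 2 * t * asin (d / t)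
  | +oo%E => 2 * d
  | -oo%E => 0
  end.

(* Main.v *)
Require Import Defs.
From mathcomp Require Import all_boot all_order all_algebra finmap.
From mathcomp Require Import generic_quotient ring lra.
From mathcomp Require Import all_classical all_reals all_analysis.

Set Implicit Arguments.
Unset Strict Implicit.
Unset Printing Implicit Defensive.

Import Order.TTheory GRing.Theory Num.Theory.
Import numFieldNormedType.Exports.

Local Open Scope classical_set_scope.
Local Open Scope ring_scope.

(** Two points of X at distance at most 2 delta < 2 tau are joined in X by a
    path of length at most 2 tau asin (delta / tau).  Along the normal
    ray through a point near X the nearest point is constant up to distance tau
    (Federer), so the open balls of radius tau tangent to X miss X, and the
    midpoint of a chord ab of X is within the sagitta of its nearest point p.
    This gives asin (|ap| / 2 tau) + asin (|pb| / 2 tau) <= asin (|ab| / 2 tau);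
    subdividing again and again and passing to the limit yields the path.

    Hence X is locally path-connected, so path components of f^-1(I) are open
    and paths of the Reeb graph lift to X up to path components.  The
    interleaving is induced by two discontinuous maps: a point of the Reeb graph
    goes to a sample near a representative, and a point of the geometric
    realization goes to the class of a vertex of weight at least 1/2.  They
    respect path components because [0, 1] is connected and is covered by the
    finitely many closed sets of times at which a given vertex is admissible. *)

(** * The Euclidean norm *)

Section EuclideanNorm.
Context {R : realType} {m : nat}.
Implicit Types x y z : 'rV[R]_m.

Definition dot x y : R := \sum_(i < m) x ord0 i * y ord0 i.

Lemma dotC x y : dot x y = dot y x.
Proof. by apply: eq_bigr => i _; rewrite mulrC. Qed.

Lemma dotDl x y z : dot (x + y) z = dot x z + dot y z.
Proof. by rewrite -big_split; apply: eq_bigr => i _; rewrite mxE mulrDl. Qed.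

Lemma dotZl a x y : dot (a *: x) y = a * dot x y.
Proof. by rewrite mulr_sumr; apply: eq_bigr => i _; rewrite mxE mulrA. Qed.

Lemma dotNl x y : dot (- x) y = - dot x y.
Proof. by rewrite -scaleN1r dotZl mulN1r. Qed.

Lemma dotDr x y z : dot x (y + z) = dot x y + dot x z.
Proof. by rewrite dotC dotDl !(dotC x). Qed.

Lemma dotZr a x y : dot x (a *: y) = a * dot x y.
Proof. by rewrite dotC dotZl (dotC x). Qed.

Lemma dotNr x y : dot x (- y) = - dot x y.
Proof. by rewrite dotC dotNl (dotC x). Qed.

Definition dotE := (dotDl, dotDr, dotZl, dotZr, dotNl, dotNr).

Lemma dot_sqrD x y : dot (x + y) (x + y) = dot x x + 2 * dot x y + dot y y.
Proof. by rewrite !dotE (dotC y x); ring. Qed.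

Lemma enorm_ge0 x : 0 <= enorm x.
Proof. exact: sqrtr_ge0. Qed.

Lemma sqr_enorm x : enorm x ^+ 2 = dot x x.
Proof.
rewrite sqr_sqrtr; first by apply: eq_bigr => i _; rewrite expr2.
by apply: sumr_ge0 => i _; exact: sqr_ge0.
Qed.

Lemma ler_enorm_coord x i : `|x ord0 i| <= enorm x.
Proof.
rewrite -sqrtr_sqr ler_wsqrtr // (bigD1 i) //= lerDl.
by apply: sumr_ge0 => j _; exact: sqr_ge0.
Qed.

Lemma enorm_eq0 x : enorm x = 0 -> x = 0.
Proof.
move=> x0; apply/rowP => i; rewrite mxE; apply/eqP.
by rewrite -normr_eq0 eq_le normr_ge0 -x0 ler_enorm_coord.
Qed.

Lemma enorm_le x r : 0 <= r -> dot x x <= r ^+ 2 -> enorm x <= r.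
Proof.
by move=> r0; rewrite -sqr_enorm ler_pXn2r // nnegrE // enorm_ge0.
Qed.

Lemma enormZ a x : enorm (a *: x) = `|a| * enorm x.
Proof.
apply/eqP; rewrite -(@eqrXn2 _ 2) ?enorm_ge0 ?mulr_ge0 ?enorm_ge0 //.
by rewrite exprMn !sqr_enorm !dotE real_normK ?num_real // expr2 mulrA.
Qed.

Lemma enormN x : enorm (- x) = enorm x.
Proof. by rewrite -scaleN1r enormZ normrN1 mul1r. Qed.

Lemma enorm0 : enorm (0 : 'rV[R]_m) = 0.
Proof. by rewrite -(scale0r 0) enormZ normr0 mul0r. Qed.

Lemma enormB x y : enorm (x - y) = enorm (y - x).
Proof. by rewrite -enormN opprB. Qed.

Lemma dot_le x y : dot x y <= enorm x * enorm y.
Proof.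
set a := enorm x; set b := enorm y.
have a0 : 0 <= a := enorm_ge0 x; have b0 : 0 <= b := enorm_ge0 y.
have [/enorm_eq0 ->|xn0] := eqVneq (enorm x) 0.
  by rewrite -(scale0r 0) dotZl mul0r mulr_ge0.
have [/enorm_eq0 ->|yn0] := eqVneq (enorm y) 0.
  by rewrite dotC -(scale0r 0) dotZl mul0r mulr_ge0.
have ab : 0 < a * b by rewrite mulr_gt0 // lt_neqAle eq_sym ?xn0 ?yn0.
have := sqr_ge0 (enorm (b *: x - a *: y)).
rewrite sqr_enorm !dotE -!sqr_enorm -/a -/b (dotC y x) => h.
have : 0 <= (a * b) * (a * b - dot x y) by nra.
by rewrite pmulr_rge0 // subr_ge0.
Qed.

Lemma ler_enormD x y : enorm (x + y) <= enorm x + enorm y.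
Proof.
apply: enorm_le; first by rewrite addr_ge0 ?enorm_ge0.
rewrite !dotE -!sqr_enorm (dotC y x); have := dot_le x y; nra.
Qed.

Lemma ler_enormB z x y : enorm (x - y) <= enorm (x - z) + enorm (z - y).
Proof. by have := ler_enormD (x - z) (z - y); rewrite addrA subrK. Qed.

Lemma ler_enorm_sum x : enorm x <= \sum_(i < m) `|x ord0 i|.
Proof.
apply: enorm_le; first by apply: sumr_ge0.
have -> : dot x x = \sum_(i < m) `|x ord0 i| ^+ 2.
  by apply: eq_bigr => i _; rewrite real_normK ?num_real // expr2.
rewrite expr2 mulr_suml; apply: ler_sum => i _.
by rewrite expr2 ler_wpM2l // (bigD1 i) //= lerDl sumr_ge0.
Qed.

Lemma enorm_lipschitz_continuous_real k (h : 'rV[R]_m -> R) : 0 <= k ->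
  (forall x y, `|h x - h y| <= k * enorm (x - y)) -> continuous h.
Proof.
move=> k0 hk x; apply/(@cvgrPdist_le _ _ _ (nbhs x) (nbhs_filter x)) => e e0.
(* Adding 1 to [k] and to [m] keeps both divisors positive when [k] or [m] is 0. *)
have e1 : 0 < e / (k + 1) / m.+1%:R by rewrite !divr_gt0 // ?ltr0n //; lra.
have : \forall y \near x, `|x - y| <= e / (k + 1) / m.+1%:R.
  by apply/nbhs_normP; exists (e / (k + 1) / m.+1%:R) => // y /ltW.
apply: filterS => y xy.
have xyi i : `|(x - y) ord0 i| <= e / (k + 1) / m.+1%:R.
  apply: le_trans xy; rewrite [leRHS]mx_normrE.
  exact: (@le_bigmax _ _ _ _ (fun ij : 'I_1 * 'I_m => `|(x - y) ij.1 ij.2|)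
    (ord0, i)).
have : enorm (x - y) <= e / (k + 1).
  apply: (le_trans (ler_enorm_sum _)).
  apply: (@le_trans _ _ (\sum_(i < m) e / (k + 1) / m.+1%:R)).
    by apply: ler_sum => i _; exact: xyi.
  rewrite sumr_const card_ord -[leLHS]mulr_natr -mulrA ger_pMr.
    by rewrite mulrC ler_pdivrMr ?ltr0n // mul1r ler_nat.
  by rewrite divr_gt0 //; lra.
rewrite ler_pdivlMr; last lra.
by move=> h1; apply: (le_trans (hk x y)); have := enorm_ge0 (x - y); nra.
Qed.

Lemma norm_le_enorm x : `|x| <= enorm x.
Proof.
rewrite /Num.norm /= mx_normrE; apply: bigmax_le; first exact: enorm_ge0.
by case=> i j _ /=; rewrite ord1 ler_enorm_coord.
Qed.

Lemma enorm_lipschitz_continuous (T : topologicalType) (x : T) (h : T -> 'rV[R]_m) :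
  (forall e, 0 < e -> \forall y \near x, enorm (h x - h y) <= e) ->
  {for x, continuous h}.
Proof.
move=> hx; apply/cvgrPdist_le => e /hx; apply: filterS => y.
exact/le_trans/norm_le_enorm.
Qed.

Lemma ler_dist_enorm x y : `|enorm x - enorm y| <= enorm (x - y).
Proof.
have := ler_enormD (x - y) y; have := ler_enormD (y - x) x.
by rewrite !subrK (enormB y) ler_norml => h1 h2; apply/andP; split; lra.
Qed.

Lemma enormB_continuous z : continuous (fun w : 'rV[R]_m => enorm (w - z)).
Proof.
apply: (@enorm_lipschitz_continuous_real 1) => // x y; rewrite mul1r.
by apply: (le_trans (ler_dist_enorm _ _)); rewrite opprB addrA subrK.
Qed.

Lemma enorm_ball_compact z r : compact [set w | enorm (w - z) <= r].
Proof.
apply: bounded_closed_compact.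
  exists (r + `|z|); split; first exact: num_real.
  move=> M rM w /= wz; apply/ltW/(le_lt_trans _ rM).
  rewrite -{1}(subrK z w); apply: (le_trans (ler_normD _ _)).
  by rewrite lerD2r; exact/(le_trans (norm_le_enorm _)).
have -> : [set w | enorm (w - z) <= r] =
    (fun w => enorm (w - z)) @^-1` [set x | x <= r].
  by [].
apply: closed_comp; last exact: closed_le.
by move=> w _; exact: enormB_continuous.
Qed.

End EuclideanNorm.

(** * Nearest points and normal rays *)

Section NearestPoint.
Context {R : realType} {m : nat}.
Implicit Types (X : set 'rV[R]_m) (w x y z p q : 'rV[R]_m).

Definition nearest X z p : Prop :=
  X p /\ forall q, X q -> enorm (z - p) <= enorm (z - q).

(** The form in which the reach enters below. The real [t] is the reach itself when that is finite
    and is arbitrary when it is infinite. *)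
Definition unique_nearest X (t : R) : Prop := forall z p q,
  nearest X z p -> nearest X z q -> enorm (z - p) < t -> p = q.

Lemma nearest_dist_to X z p : nearest X z p -> dist_to X z = (enorm (z - p))%:E.
Proof.
case=> Xp minp; apply/eqP; rewrite eq_le; apply/andP; split.
  by apply: ereal_inf_lbound; exists p.
by apply: le_ereal_inf_tmp => _ [q Xq <-]; rewrite lee_fin minp.
Qed.

(** A second nearest point would put [z] on the medial axis and bound the reach by the distance of
    [z] to [X]. *)
Lemma unique_nearest_reach X t : (t%:E <= reach X)%E -> unique_nearest X t.
Proof.
move=> tX z p q np nq zpt; apply: contrapT => pq.
suff : (reach X <= (enorm (z - p))%:E)%E.
  by move=> /(le_trans tX); rewrite lee_fin leNgt zpt.
apply: ereal_inf_lbound; exists z; last exact: nearest_dist_to np.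
exists p, q; split=> //; split; rewrite ?(nearest_dist_to np) //;
  [by case: np|by case: nq|].
by rewrite -(nearest_dist_to np) -(nearest_dist_to nq).
Qed.

Lemma nearest_exists X z : compact X -> X !=set0 -> exists p, nearest X z p.
Proof.
move=> cX X0.
have [|p pX minp] := compact_EVT_min (f := fun w => enorm (w - z)) X0 cX.
  by apply: continuous_subspaceT; exact: enormB_continuous.
exists p; split; first exact: set_mem.
by move=> q Xq; rewrite !(enormB z) minp // mem_set.
Qed.

Lemma nearest_lipschitz X w z p q : nearest X w p -> nearest X z q ->
  enorm (w - p) <= enorm (w - z) + enorm (z - q).
Proof.
by move=> [_ minp] [/minp wq _]; apply: (le_trans wq); exact: ler_enormB.
Qed.

(** The points of [X] at distance at least [c] from [p] form a compact set [K]. By uniqueness [K] is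
    strictly farther from [w] than [p] is, and half of this gap serves as [h0]. *)
Lemma nearest_stable X w p c : compact X -> nearest X w p -> 0 < c ->
  (forall q, nearest X w q -> p = q) ->
  exists2 h0, 0 < h0 & forall z q, enorm (z - w) < h0 -> nearest X z q ->
    enorm (q - p) < c.
Proof.
move=> cX np c0 uniqp.
pose K := X `&` [set q | c <= enorm (q - p)].
have cK : compact K.
  apply: compact_closedI => //.
  apply: (@closed_comp _ _ (fun q => enorm (q - p)) [set x | c <= x]).
    by move=> q _; exact: enormB_continuous.
  exact: closed_ge.
have [K0|/nonemptyPn K0] := pselect (K !=set0); last first.
  exists 1 => // z q _ [Xq _]; rewrite ltNge; apply/negP => cq.
  by have : K q by []; rewrite K0.
have [k [[Xk pk] mink]] := nearest_exists w cK K0.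
have kw : enorm (w - p) < enorm (w - k).
  rewrite lt_neqAle np.2 // andbT; apply/eqP => e.
  have nk : nearest X w k by split=> // q Xq; rewrite -e np.2.
  by move: pk; rewrite /= (uniqp _ nk) subrr enorm0 leNgt c0.
exists ((enorm (w - k) - enorm (w - p)) / 2); first lra.
move=> z q zw nq; rewrite ltNge; apply/negP => cq.
have := mink q (conj nq.1 cq).
have := nearest_lipschitz nq np; have := ler_enormB z w q.
by rewrite (enormB w z); lra.
Qed.

(* [z] is [w] pushed along the normal [w - p]; by [nearest_stable] its nearest
   point stays close to [p]. *)
Lemma nearest_ascent X w p k h1 : compact X -> nearest X w p -> 0 < enorm (w - p) ->
  (forall q, nearest X w q -> p = q) -> 0 < k -> 0 < h1 ->
  exists z q, [/\ nearest X z q, 0 < enorm (z - w), enorm (z - w) <= h1 &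
    enorm (w - p) + (1 - k) * enorm (z - w) < enorm (z - q)].
Proof.
(* The claim weakens as [k] grows, so [1 / 2] stands in for any [k] that is at least 1. *)
move=> cX np d0 uniqp; wlog k1 : k / k < 1.
  move=> hk k0 h10; have [/hk|k1] := ltP k 1; first exact.
  have [||//|z [q [nq z0 zh zq]]] := hk (1 / 2); [lra|lra|].
  by exists z, q; split => //; apply: le_lt_trans zq; nra.
move=> k0 h10.
set d := enorm (w - p) in d0 *.
have [|h0 h00 stable] := nearest_stable cX np (c := k * d / 2) _ uniqp.
  by rewrite divr_gt0 // mulr_gt0.
pose h := Num.min h1 (h0 / 2); pose z := w + (h / d) *: (w - p).
have h_gt0 : 0 < h by rewrite lt_min; apply/andP; split; lra.
have hh1 : h <= h1 by rewrite ge_min lexx.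
have hh0 : h <= h0 / 2 by rewrite ge_min lexx orbT.
have zw : z - w = (h / d) *: (w - p) by rewrite /z addrC addKr.
have ezw : enorm (z - w) = h.
  by rewrite zw enormZ -/d ger0_norm ?divfK ?gt_eqF // ltW // divr_gt0.
have [q nq] := nearest_exists z cX (ex_intro _ p np.1).
exists z, q; rewrite ezw; split=> //.
have qp : enorm (q - p) < k * d / 2 by apply: (stable z); rewrite ?ezw //; lra.
have wpq : d <= enorm (w - q) := np.2 q nq.1.
have dpq : - (k * d / 2 * d) < dot (w - p) (p - q).
  have := dot_le (w - p) (q - p); rewrite -(opprB q p) dotNr -/d => h2.
  nra.
(* With [|w - q| >= d] and the bound on the scalar product, the right-hand side exceeds
   [d^2 + (2 - k) h d + h^2], hence [(d + (1 - k) h)^2]. *)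
have zq2 : enorm (z - q) ^+ 2 = enorm (w - q) ^+ 2 +
    2 * (h / d) * (d ^+ 2 + dot (w - p) (p - q)) + h ^+ 2.
  have -> : z - q = (w - q) + (z - w) by rewrite [RHS]addrC addrA subrK.
  have -> : h ^+ 2 = dot (z - w) (z - w) by rewrite -sqr_enorm ezw.
  rewrite !sqr_enorm dot_sqrD.
  have -> : dot (w - q) (z - w) = (h / d) * (d ^+ 2 + dot (w - p) (p - q)).
    rewrite zw dotZr; congr (_ * _); rewrite /d sqr_enorm -dotDr dotC.
    by rewrite addrA subrK.
  by rewrite [d ^+ 2]sqr_enorm; ring.
have e : h / d * d = h by rewrite divfK ?gt_eqF.
have hd0 : 0 < h / d by rewrite divr_gt0.
have zq0 := enorm_ge0 (z - q).
rewrite ltNge; apply/negP => le_zq.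
have h2 : enorm (z - q) ^+ 2 <= (d + (1 - k) * h) ^+ 2.
  rewrite ler_pXn2r // nnegrE; apply: addr_ge0; first exact: ltW.
  by apply: mulr_ge0; [lra|exact: ltW].
have h3 : d ^+ 2 <= enorm (w - q) ^+ 2 by rewrite ler_pXn2r // nnegrE enorm_ge0.
have h4 : h / d * (d ^+ 2 + dot (w - p) (p - q)) > h * d - h * (k * d / 2).
  have -> : h * d - h * (k * d / 2) = h / d * (d ^+ 2 - k * d / 2 * d).
    by rewrite -{1 2}e; ring.
  by rewrite ltr_pM2l //; lra.
have h5 : 0 < h * d by rewrite mulr_gt0.
nra.
Qed.

Section UniqueNearest.
Variables (X : set 'rV[R]_m) (t : R).
Hypotheses (cX : compact X) (uX : unique_nearest X t).

(* By [nearest_ascent], the maximum over the ball of the distance to [X] minus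
   [(1 - k) |w - z|] is reached on the sphere; then [k] tends to 0. *)
Lemma farthest_in_ball z p r : nearest X z p -> 0 < enorm (z - p) ->
  0 <= r -> enorm (z - p) + r < t ->
  exists w, enorm (w - z) <= r /\
    forall q, nearest X w q -> enorm (z - p) + r <= enorm (w - q).
Proof.
move=> np d0 r0 drt; set d := enorm (z - p) in d0 drt *.
have X0 : X !=set0 by exists p; exact: np.1.
have [pi npi] := choice (fun w => nearest_exists w cX X0).
pose D w := enorm (w - pi w).
have DE w q : nearest X w q -> D w = enorm (w - q).
  move=> nq; apply/eqP; rewrite eq_le.
  by rewrite (npi w).2 ?nq.2 //; [exact: (npi w).1|exact: nq.1].
have Dlip w x : `|D w - D x| <= enorm (w - x).
  have := nearest_lipschitz (npi w) (npi x).
  have := nearest_lipschitz (npi x) (npi w).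
  by rewrite (enormB x w) -/(D w) -/(D x) => h1 h2; rewrite ler_norml; apply/andP; split; lra.
pose B := [set w | enorm (w - z) <= r].
have cB : compact B := @enorm_ball_compact R m z r.
have B0 : B !=set0 by exists z; rewrite /B /= subrr enorm0.
have near_max k : 0 < k -> k < 1 -> exists2 w, B w & d + (1 - k) * r <= D w.
  move=> k0 k1; pose phi w := D w - (1 - k) * enorm (w - z).
  have [|w /set_mem Bw maxw] := compact_EVT_max (f := phi) B0 cB.
    apply: continuous_subspaceT; apply: (@enorm_lipschitz_continuous_real _ _ 2) => // x y.
    have := Dlip x y; have := ler_dist_enorm (x - z) (y - z).
    rewrite opprB addrA subrK /phi => h1 h2.
    have -> : D x - (1 - k) * enorm (x - z) - (D y - (1 - k) * enorm (y - z)) =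
      (D x - D y) - (1 - k) * (enorm (x - z) - enorm (y - z)) by ring.
    have k1' : 0 <= 1 - k by lra.
    apply: (le_trans (ler_normB _ _)); rewrite normrM (ger0_norm k1').
    have := normr_ge0 (enorm (x - z) - enorm (y - z)); nra.
  have /maxw : z \in B by rewrite inE /B /= subrr enorm0.
  rewrite /phi subrr enorm0 mulr0 subr0 (DE _ _ np) -/d => zw.
  have wz0 := enorm_ge0 (w - z).
  (* A maximum inside the ball is impossible: [nearest_ascent] moves it outwards within the ball,
     and [D] grows faster than the penalty. *)
  have [wr|rw] := ltP (enorm (w - z)) r; last by exists w => //; nra.
  have Dw0 : 0 < D w by nra.
  have Dwt : D w < t.
    have := Dlip w z; rewrite (DE _ _ np) -/d ler_norml => /andP[_ h]; lra.
  have [|||z' [q [nq zw0 zwr zq]]] :=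
    @nearest_ascent X w (pi w) k (r - enorm (w - z)) cX (npi w) Dw0.
  - by move=> q nq; apply: (uX (npi w) nq).
  - by [].
  - lra.
  have Bz' : B z' by have := ler_enormB w z' z; rewrite /B /=; lra.
  have := maxw z' (mem_set Bz'); rewrite /phi (DE _ _ nq) leNgt => /negP[].
  have := ler_enormB w z' z; move: zq; rewrite -/(D w) => h1 h2; nra.
(* In place of a limit in [k], take a maximum of [D] itself: it dominates every point given by
   [near_max]. *)
have [|w /set_mem Bw maxw] := compact_EVT_max (f := D) B0 cB.
  apply: continuous_subspaceT; apply: (@enorm_lipschitz_continuous_real _ _ 1) => // x y.
  by rewrite mul1r.
exists w; split=> // q nq; rewrite -(DE _ _ nq) leNgt; apply/negP => Dw.
have [r00|rn0] := eqVneq r 0.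
  by have := maxw z; rewrite inE /B /= subrr enorm0 (DE _ _ np) -/d => /(_ r0); lra.
have r_gt0 : 0 < r by rewrite lt_neqAle eq_sym rn0.
(* Then [k r] is at most half of the shortfall [d + r - D w], so [near_max] beats the maximum. *)
pose k := Num.min (1 / 2) ((d + r - D w) / (2 * r)).
have k0 : 0 < k by rewrite lt_min; apply/andP; split; [lra|rewrite divr_gt0 //; lra].
have k1 : k <= 1 / 2 by rewrite ge_min lexx.
have k2 : k <= (d + r - D w) / (2 * r) by rewrite ge_min lexx orbT.
have [||w' Bw' Dw'] := near_max k; [by []|lra|].
have := maxw w' (mem_set Bw').
move: k2; rewrite ler_pdivlMr; last lra.
nra.
Qed.

(* By the equality case of the triangle inequality, the point of the ball
   farthest from [X] is the end of the normal ray. *)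
Lemma nearest_normal_ray z p r : nearest X z p -> 0 < enorm (z - p) ->
  0 <= r -> enorm (z - p) + r < t ->
  nearest X (z + (r / enorm (z - p)) *: (z - p)) p.
Proof.
move=> np d0 r0 drt; have [w [wz far]] := farthest_in_ball np d0 r0 drt.
set d := enorm (z - p) in d0 drt far *.
have X0 : X !=set0 by exists p; exact: np.1.
have [q nq] := nearest_exists w cX X0; have {}far := far q nq.
have wp : d + r <= enorm (w - p) by apply: (le_trans far); apply: nq.2; exact: np.1.
have -> : z + (r / d) *: (z - p) = w.
  apply/eqP; rewrite eq_sym -subr_eq0; apply/eqP/enorm_eq0/eqP.
  rewrite eq_le enorm_ge0 andbT enorm_le // expr0n /=.
  have -> : w - (z + (r / d) *: (z - p)) = (w - z) + (- (r / d)) *: (z - p).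
    by rewrite opprD addrA scaleNr.
  rewrite dot_sqrD !(dotZl, dotZr) -!sqr_enorm -/d.
  have h1 : enorm (w - p) ^+ 2 = enorm (w - z) ^+ 2 + 2 * dot (w - z) (z - p) + d ^+ 2.
    by rewrite /d !sqr_enorm -dot_sqrD addrA subrK.
  have h2 : (d + r) ^+ 2 <= enorm (w - p) ^+ 2.
    by rewrite ler_pXn2r // nnegrE ?enorm_ge0 // addr_ge0 // ltW.
  have h3 : enorm (w - z) ^+ 2 <= r ^+ 2 by rewrite ler_pXn2r // nnegrE enorm_ge0.
  have e : r / d * d = r by rewrite divfK ?gt_eqF.
  have rd0 : 0 <= r / d by rewrite divr_ge0 // ltW.
  have -> : - (r / d) * (- (r / d) * d ^+ 2) = r ^+ 2 by rewrite -{3}e; ring.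
  have h4 : r * d <= dot (w - z) (z - p) by nra.
  have : r / d * (r * d) <= r / d * dot (w - z) (z - p) by rewrite ler_wpM2l.
  have -> : r / d * (r * d) = r ^+ 2 by rewrite [r * d]mulrC mulrA e expr2.
  lra.
split=> [|q' Xq']; first exact: np.1.
apply: (@le_trans _ _ (d + r)); last by apply: (le_trans far); exact: nq.2.
have := ler_enormB z w p; rewrite -/d; lra.
Qed.

End UniqueNearest.
End NearestPoint.

(** * The arcsine *)

Section Arcsine.
Context {R : realType}.
Implicit Types x y w : R.

Lemma sin_MVT x y : x < y ->
  exists2 c, x < c < y & sin y - sin x = cos c * (y - x).
Proof.
move=> xy; have [|c] := MVT xy (fun c _ => is_derive_sin c).
- by apply: continuous_subspaceT; exact: continuous_sin.
- by rewrite in_itv /= => cxy e; exists c.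
Qed.

Lemma sin_le_id x : 0 <= x -> sin x <= x.
Proof.
rewrite le_eqVlt => /orP[/eqP <-|x0]; first by rewrite sin0.
have [c _] := sin_MVT x0; rewrite sin0 !subr0 => ->.
by rewrite ler_piMl ?cos_le1 // ltW.
Qed.

Lemma le_asin : {in `[(-1), 1] &, {homo (@asin R) : x y / x <= y}}.
Proof.
move=> x y x1 y1 xy; rewrite leNgt; apply/negP => h.
have asin_itv z : z \in `[(-1), 1] -> asin z \in `[- (pi / 2), (pi / 2)].
  by rewrite !in_itv /= => z1; rewrite asin_geNpi2 ?asin_lepi2.
have : sin (asin y) < sin (asin x) by rewrite ltr_sin // asin_itv.
by rewrite !asinK // ltNge xy.
Qed.

Lemma asin0 : asin 0 = 0 :> R.
Proof.
by rewrite -{1}sin0 sinK // in_itv /= oppr_le0 divr_ge0 ?pi_ge0.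
Qed.

Lemma asin_ge0 x : 0 <= x <= 1 -> 0 <= asin x.
Proof.
move=> /andP[x0 x1]; rewrite -asin0.
by rewrite le_asin // in_itv /=; apply/andP; split; lra.
Qed.

Lemma id_le_asin x : 0 <= x <= 1 -> x <= asin x.
Proof.
move=> x1; rewrite -{1}(@asinK R x); first by apply/sin_le_id/asin_ge0.
by rewrite in_itv /=; case/andP: x1 => *; apply/andP; split; lra.
Qed.

(** Let a, b, c be the arcsines of [x], [y], [w]. The hypothesis says that cos (a + b) cos (a - b)
    >= cos c > 0. As cos (a - b) lies in [0, 1], this gives cos (a + b) >= cos c, and cos decreases
    on [0, pi]. *)
Lemma asinD_le x y w : 0 <= x -> 0 <= y -> 0 <= w -> w < 1 ->
  x ^+ 2 + y ^+ 2 <= 1 - Num.sqrt (1 - w ^+ 2) -> asin x + asin y <= asin w.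
Proof.
move=> x0 y0 w0 w1 h.
have ws0 : 0 < 1 - w ^+ 2 by rewrite subr_gt0 expr_lt1.
have s0 : 0 < Num.sqrt (1 - w ^+ 2) by rewrite sqrtr_gt0.
have lt1 z : 0 <= z -> z ^+ 2 < 1 -> z < 1 by move=> z0; rewrite expr_lt1.
have x1 : x < 1 by apply: lt1 => //; have := sqr_ge0 y; lra.
have y1 : y < 1 by apply: lt1 => //; have := sqr_ge0 x; lra.
have ax0 : 0 <= asin x by rewrite asin_ge0 // x0 ltW.
have ay0 : 0 <= asin y by rewrite asin_ge0 // y0 ltW.
have aw0 : 0 <= asin w by rewrite asin_ge0 // w0 ltW.
have ax1 : asin x <= pi / 2 by rewrite asin_lepi2; lra.
have ay1 : asin y <= pi / 2 by rewrite asin_lepi2; lra.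
have aw1 : asin w <= pi / 2 by rewrite asin_lepi2; lra.
have sx : sin (asin x) = x by rewrite asinK // in_itv /=; lra.
have sy : sin (asin y) = y by rewrite asinK // in_itv /=; lra.
have cw : cos (asin w) = Num.sqrt (1 - w ^+ 2) by rewrite cos_asin //; lra.
rewrite leNgt; apply/negP => wxy.
have : cos (asin x + asin y) < cos (asin w).
  by rewrite ltr_cos // in_itv /=; apply/andP; split; lra.
have cxy : 0 <= cos (asin x - asin y).
  by rewrite cos_ge0_pihalf //; apply/andP; split; lra.
(* [2 cos (a + b) cos (a - b) = cos (2 a) + cos (2 b) = 2 - 2 x^2 - 2 y^2] *)
have e : cos (asin x + asin y) * cos (asin x - asin y) = 1 - x ^+ 2 - y ^+ 2.
  rewrite cosD cosB.
  have := cos2sin2 (asin x); have := cos2sin2 (asin y); rewrite sx sy => cy cx.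
  transitivity (cos (asin x) ^+ 2 * cos (asin y) ^+ 2 - x ^+ 2 * y ^+ 2).
    by ring.
  by rewrite cx cy; ring.
have c1 := @cos_le1 R (asin x - asin y).
rewrite cw; set C := cos (asin x + asin y) in e *; set c := cos (_ - _) in e c1 cxy.
move=> CS.
have [C0|C0] := leP C 0; nra.
Qed.

(** The double of pi / 3 is also its supplement, so c = cos (pi / 3) satisfies (2 c - 1) (c + 1) =
    0, and c > 0. *)
Lemma sin_pi6 : sin (pi / 6) = 1 / 2 :> R.
Proof.
have pi0 := @pi_gt0 R.
have -> : pi / 6 = - (pi / 3 - pi / 2) :> R by field.
rewrite sinN sinBpihalf opprK.
have c0 : 0 < cos (pi / 3 : R) by apply: cos_gt0_pihalf; lra.
have : cos (pi - pi / 3 : R) = cos ((pi / 3) *+ 2) by congr cos; field.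
rewrite cosB cospi sinpi mul0r addr0 mulN1r cos_mulr2n -[_ *+ 2]mulr_natr => h.
have : (2 * cos (pi / 3 : R) - 1) * (cos (pi / 3 : R) + 1) = 0 by nra.
move/eqP; rewrite mulf_eq0 => /orP[/eqP|/eqP]; lra.
Qed.

(** Serves the case of infinite reach, where [reach_eta] is [2 * d] and has to be at most
    [2 * pi / 3 * d]. *)
Lemma pi_ge3 : 3 <= pi :> R.
Proof.
have pi0 := @pi_gt0 R.
have : sin (pi / 6) <= pi / 6 :> R by apply: sin_le_id; lra.
rewrite sin_pi6; lra.
Qed.

(* On [0, pi/6] the concave function sin lies above its chord. *)
Lemma asin_le_chord x : 0 <= x -> x < 1 / 2 -> asin x <= pi / 3 * x.
Proof.
rewrite le_eqVlt => /orP[/eqP <- _|x0 x12].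
  by rewrite asin0 mulr0.
have pi0 := @pi_gt0 R.
have x1 : x \in `[(-1), 1] by rewrite in_itv /=; lra.
have sv := asinK x1; set v := asin x in sv *.
have v0 : 0 < v by apply: (lt_le_trans x0); apply: id_le_asin; lra.
have v6 : v < pi / 6.
  have v2 : v <= pi / 2 by apply: asin_lepi2; lra.
  have vI : v \in `[- (pi / 2), pi / 2] by rewrite in_itv /=; lra.
  have pI : pi / 6 \in `[- (pi / 2), pi / 2 : R] by rewrite in_itv /=; lra.
  by rewrite -(ltr_sin vI pI) sv sin_pi6.
(* [cos c] and [cos c'] are the slopes of sin over [0, v] and [v, pi / 6]; concavity is the fact
   that the first is larger. *)
have [c /andP[c0 cv]] := sin_MVT v0; rewrite sin0 !subr0 sv => e1.
have [c' /andP[vc' c'6]] := sin_MVT v6; rewrite sin_pi6 sv => e2.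
have : cos c' < cos c.
  have cI : c \in `[0, pi : R] by rewrite in_itv /=; lra.
  have c'I : c' \in `[0, pi : R] by rewrite in_itv /=; lra.
  by rewrite ltr_cos //; lra.
move=> cc'.
have : x * (pi / 6 - v) >= v * (1 / 2 - x).
  rewrite e2 {1}e1; have := mulr_gt0 v0 (_ : 0 < pi / 6 - v); nra.
lra.
Qed.

End Arcsine.

(** * Midpoints of chords *)

Section Midpoint.
Context {R : realType} {m : nat}.
Implicit Types (X : set 'rV[R]_m) (a b z p q : 'rV[R]_m).

Definition midpoint a b := 2^-1 *: (a + b).

Lemma midpointBl a b : midpoint a b - a = 2^-1 *: (b - a).
Proof. by apply/rowP => i; rewrite !mxE; field. Qed.

Lemma midpointBr a b : midpoint a b - b = - (2^-1 *: (b - a)).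
Proof. by apply/rowP => i; rewrite !mxE; field. Qed.

Lemma enorm_half a : enorm (2^-1 *: a) = enorm a / 2.
Proof. by rewrite enormZ ger0_norm ?invr_ge0 // mulrC. Qed.

Lemma parallelogram a b :
  enorm (a + b) ^+ 2 + enorm (a - b) ^+ 2 = 2 * (enorm a ^+ 2 + enorm b ^+ 2).
Proof. by rewrite !sqr_enorm !dotE (dotC b a); ring. Qed.

(** The last inequality says that [s] is at most the sagitta [t - sqrt (t^2 - u^2)]. If it fails,
    follow the normal ray from [p] through the midpoint by a further [r]: [a] and [b] lie outside
    the open ball of radius [s + r] around the point reached, and the parallelogram law gives
    [(s + r)^2 <= r^2 + u^2], which is false for [r] close to [t - s]. *)
Lemma midpoint_sagitta X t a b p : compact X -> unique_nearest X t ->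
  X a -> X b -> nearest X (midpoint a b) p -> enorm (a - b) / 2 < t ->
  enorm (midpoint a b - p) <= enorm (a - b) / 2 /\
  2 * t * enorm (midpoint a b - p) - enorm (midpoint a b - p) ^+ 2
    <= (enorm (a - b) / 2) ^+ 2.
Proof.
move=> cX uX Xa Xb np; set u := _ / 2; set s := enorm (_ - p) => ut.
have u0 : 0 <= u by rewrite divr_ge0 ?enorm_ge0.
have su : s <= u.
  apply: (le_trans (np.2 a Xa)).
  by rewrite midpointBl enorm_half enormB.
split=> //; rewrite leNgt; apply/negP => us.
have s0 : 0 < s.
  rewrite lt_neqAle enorm_ge0 andbT eq_sym; apply/eqP => s0.
  by move: us; rewrite s0 mulr0 expr0n /= subr0 ltNge sqr_ge0.
(* The mean of the value beyond which the contradiction occurs and of the bound [t - s] imposed by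
   the reach. *)
pose r := ((u ^+ 2 - s ^+ 2) / (2 * s) + (t - s)) / 2.
have e : (u ^+ 2 - s ^+ 2) / (2 * s) * s = (u ^+ 2 - s ^+ 2) / 2.
  by field; rewrite gt_eqF.
have us0 : 0 <= (u ^+ 2 - s ^+ 2) / (2 * s) by rewrite divr_ge0 //; nra.
have us1 : (u ^+ 2 - s ^+ 2) / (2 * s) < t - s.
  by rewrite -(ltr_pM2r s0) e; nra.
have r0 : 0 <= r by rewrite /r; lra.
have rs0 : 0 <= r / s by rewrite divr_ge0 // ltW.
have srt : s + r < t by rewrite /r; lra.
have [_ h] := nearest_normal_ray cX uX np s0 r0 srt.
set v := (r / s) *: (midpoint a b - p) in h.
have ev : enorm v = r.
  by rewrite enormZ ger0_norm // divfK ?gt_eqF.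
have evp : enorm (midpoint a b + v - p) = s + r.
  have -> : midpoint a b + v - p = (1 + r / s) *: (midpoint a b - p).
    by rewrite scalerDl scale1r addrAC.
  rewrite enormZ ger0_norm -/s; last by rewrite addr_ge0.
  by rewrite mulrDl mul1r divfK ?gt_eqF.
have ha := h a Xa; have hb := h b Xb.
rewrite evp addrAC midpointBl addrC in ha.
rewrite evp addrAC midpointBr addrC in hb.
have := parallelogram v (2^-1 *: (b - a)).
rewrite enorm_half (enormB b a) -/u ev => e2.
have ha2 : (s + r) ^+ 2 <= enorm (v + 2^-1 *: (b - a)) ^+ 2.
  by rewrite ler_pXn2r // nnegrE ?enorm_ge0 //; lra.
have hb2 : (s + r) ^+ 2 <= enorm (v - 2^-1 *: (b - a)) ^+ 2.
  by rewrite ler_pXn2r // nnegrE ?enorm_ge0 //; lra.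
have : 2 * r * s = (u ^+ 2 - s ^+ 2) / 2 + (t - s) * s.
  by rewrite -e /r; field; rewrite gt_eqF.
nra.
Qed.

(* The geodesic bound passes to the halves through the nearest point of the
   midpoint, which lies within the sagitta of the chord of radius [t]. *)
Lemma midpoint_asin X t d a b : compact X -> unique_nearest X t ->
  0 < d -> d < t -> X a -> X b -> enorm (a - b) <= 2 * d ->
  exists p, [/\ X p,
    2 * t * asin (enorm (a - p) / (2 * t)) +
      2 * t * asin (enorm (p - b) / (2 * t))
      <= 2 * t * asin (enorm (a - b) / (2 * t)),
    enorm (a - p) <= (1 + d / t) / 2 * enorm (a - b) &
    enorm (p - b) <= (1 + d / t) / 2 * enorm (a - b)].
Proof.
move=> cX uX d0 dt Xa Xb ab.
have [p np] := nearest_exists (midpoint a b) cX (ex_intro _ a Xa).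
have [|] := midpoint_sagitta cX uX Xa Xb np; first lra.
set u := enorm (a - b) / 2; set s := enorm (_ - p) => su sag.
have t0 : 0 < t by lra.
have s0 : 0 <= s := enorm_ge0 _.
have ud : u <= d by rewrite /u; lra.
have -> : enorm (a - b) = 2 * u by rewrite /u; field.
have half : enorm (2^-1 *: (b - a)) = u by rewrite enorm_half enormB.
(* As [s <= t], the sagitta bound gives [s t <= u^2 <= u d]; this is where the contraction factor
   comes from. *)
have sut : s * t <= u * d by nra.
have us : u + s <= (1 + d / t) / 2 * (2 * u).
  have : s <= u * d / t by rewrite ler_pdivlMr.
  by have -> : (1 + d / t) / 2 * (2 * u) = u + u * d / t; [field; lra|lra].
have ap : enorm (a - p) <= u + s.
  have := ler_enormB (midpoint a b) a p.
  by rewrite (enormB a (midpoint a b)) midpointBl half.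
have bp : enorm (p - b) <= u + s.
  have := ler_enormB (midpoint a b) p b.
  rewrite (enormB p (midpoint a b)) midpointBr enormN half -/s.
  lra.
exists p; split; [exact: np.1| |exact: le_trans us|exact: le_trans us].
rewrite -mulrDr ler_pM2l; last lra.
have u0 : 0 <= u by rewrite /u divr_ge0 ?enorm_ge0.
apply: asinD_le; rewrite ?divr_ge0 ?enorm_ge0 //; try lra.
  by rewrite ltr_pdivrMr; lra.
have -> : 2 * u / (2 * t) = u / t by field; lra.
set c := Num.sqrt _.
have c0 : 0 <= c := sqrtr_ge0 _.
have ut0 : 0 <= u / t by rewrite divr_ge0 // ltW.
have ut1 : u / t < 1 by rewrite ltr_pdivrMr; lra.
have c2 : (t * c) ^+ 2 = t ^+ 2 - u ^+ 2.
  rewrite exprMn sqr_sqrtr; first by field; lra.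
  by rewrite subr_ge0 expr_le1 // ltW.
have tcs : t * c <= t - s.
  by rewrite -(@ler_pXn2r _ 2) // ?nnegrE ?mulr_ge0 //; nra.
(* The median identity in the triangle [a p b]. *)
have e : enorm (a - p) ^+ 2 + enorm (p - b) ^+ 2 = 2 * (s ^+ 2 + u ^+ 2).
  have := parallelogram (midpoint a b - p) (2^-1 *: (b - a)).
  have -> : midpoint a b - p + 2^-1 *: (b - a) = b - p.
    by apply/rowP => i; rewrite !mxE; field.
  have -> : midpoint a b - p - 2^-1 *: (b - a) = a - p.
    by apply/rowP => i; rewrite !mxE; field.
  by rewrite half -/s (enormB p b) addrC.
have -> : (enorm (a - p) / (2 * t)) ^+ 2 + (enorm (p - b) / (2 * t)) ^+ 2 =
    (s ^+ 2 + u ^+ 2) / (2 * t ^+ 2).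
  have -> : s ^+ 2 + u ^+ 2 = (enorm (a - p) ^+ 2 + enorm (p - b) ^+ 2) / 2.
    by rewrite e; field.
  by field; lra.
(* By [tcs] and [c2], [s^2 + u^2 <= t^2 (1 - c)^2 + t^2 (1 - c^2) = 2 t^2 (1 - c)]. *)
rewrite ler_pdivrMr; nra.
Qed.

End Midpoint.

(** * Lipschitz paths by compactness *)

Section LipschitzPaths.
Context {R : realType} {m : nat}.
Implicit Types (X : set 'rV[R]_m) (a b p : 'rV[R]_m) (g : R -> 'rV[R]_m).

(** A unit-speed path up to jumps of size [e]. The bound from the starting point carries no error
    term, so that concatenation does not add up errors and the limit starts at [a]. *)
Definition coarse_path X a b l (e : R) g : Prop :=
  [/\ forall t, X (g t), forall t, l <= t -> g t = b,
      forall t, 0 <= t -> enorm (g t - a) <= t &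
      forall t t', t <= t' -> enorm (g t - g t') <= t' - t + e].

(** Wait at [a] until time [l], then jump to [b]. *)
Lemma coarse_path_step X a b l e : X a -> X b ->
  enorm (a - b) <= l -> enorm (a - b) <= e ->
  exists g, coarse_path X a b l e g.
Proof.
move=> Xa Xb abl abe; have e0 := le_trans (enorm_ge0 _) abe.
exists (fun t => if t < l then a else b); split.
- by move=> t; case: ifP.
- by move=> t; rewrite leNgt => /negbTE ->.
- move=> t t0; case: ltP => lt; first by rewrite subrr enorm0.
  by rewrite enormB (le_trans abl).
- move=> t t' tt'; case: ltP => h; case: ltP => h'; rewrite ?subrr ?enorm0; lra.
Qed.

Lemma coarse_path_cat X a p b l l' e g g' : 0 <= l -> 0 <= l' ->
  coarse_path X a p l e g -> coarse_path X p b l' e g' ->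
  exists h, coarse_path X a b (l + l') e h.
Proof.
move=> l0 l'0 [Xg gl ga gL] [Xg' gl' ga' gL'].
have gtp := gl l (lexx l).
exists (fun t => if t < l then g t else g' (t - l)); split.
- by move=> t; case: ifP.
- by move=> t lt; case: ltP => h; [exfalso; lra|apply: gl'; lra].
- move=> t t0; case: ltP => h; first exact: ga.
  have := ler_enormB p (g' (t - l)) a; have := ga' (t - l) (_ : 0 <= t - l).
  rewrite subr_ge0 => /(_ h); have := ga l l0; rewrite gtp; lra.
- move=> t t' tt'; case: ltP => h; case: ltP => h'.
  + exact: gL.
  + have := ler_enormB p (g t) (g' (t' - l)); have := gL t l (ltW h).
    have := ga' (t' - l) (_ : 0 <= t' - l); rewrite subr_ge0 => /(_ h').
    rewrite gtp (enormB p); lra.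
  + lra.
  + have := gL' (t - l) (t' - l) (_ : t - l <= t' - l).
    rewrite lerD2r => /(_ tt'); lra.
Qed.

(** Each subdivision shrinks the chords by [lam] and does not increase the total of [L]. The
    induction is on the number of subdivisions after which all chords are at most [e]. *)
Lemma coarse_path_exists X (L : 'rV[R]_m -> 'rV[R]_m -> R) D lam :
  (forall a b, X a -> X b -> enorm (a - b) <= D -> enorm (a - b) <= L a b) ->
  0 <= lam -> lam < 1 ->
  (forall a b, X a -> X b -> enorm (a - b) <= D -> exists p, [/\ X p,
    L a p + L p b <= L a b, enorm (a - p) <= lam * enorm (a - b) &
    enorm (p - b) <= lam * enorm (a - b)]) ->
  forall a b e, X a -> X b -> enorm (a - b) <= D -> 0 < e ->
  exists g, coarse_path X a b (L a b) e g.
Proof.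
move=> Lge lam0 lam1 mid a b e Xa Xb ab e0.
have [n] : exists n, enorm (a - b) * lam ^+ n <= e.
  have e1 : 0 < e / (enorm (a - b) + 1) by rewrite divr_gt0 // ltr_wpDl // enorm_ge0.
  have /cvgrPdist_lt /(_ _ e1) : (GRing.exp lam : nat -> R) @ \oo --> (0 : R).
    by apply: cvg_expr; rewrite ger0_norm.
  case=> N _ /(_ N (leqnn N)) /=; rewrite sub0r normrN ger0_norm ?exprn_ge0 //.
  rewrite ltr_pdivlMr ?ltr_wpDl ?enorm_ge0 // => h; exists N.
  have := exprn_ge0 N lam0; have := enorm_ge0 (a - b); nra.
elim: n a b Xa Xb ab => [|n IH] a b Xa Xb ab.
  by rewrite expr0 mulr1 => abe; apply: coarse_path_step => //; exact: Lge.
rewrite exprS mulrA => abn.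
have [p [Xp Lp ap pb]] := mid a b Xa Xb ab.
have lab : lam * enorm (a - b) <= enorm (a - b) by rewrite ler_piMl ?enorm_ge0 // ltW.
have shorter x : x <= lam * enorm (a - b) -> x <= D /\ x * lam ^+ n <= e.
  move=> xl; split; first by apply: (le_trans xl); apply: le_trans ab.
  by apply: le_trans abn; rewrite [enorm _ * lam]mulrC ler_wpM2r // exprn_ge0.
have [apD apn] := shorter _ ap; have [pbD pbn] := shorter _ pb.
have [g gP] := IH a p Xa Xp apD apn.
have [g' gP'] := IH p b Xp Xb pbD pbn.
have Lap := le_trans (enorm_ge0 _) (Lge a p Xa Xp apD).
have Lpb := le_trans (enorm_ge0 _) (Lge p b Xp Xb pbD).
have [h [Xh hl ha hL]] := coarse_path_cat Lap Lpb gP gP'.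
(* The concatenation arrives by time [L a p + L p b <= L a b] and then rests at [b]. *)
by exists h; split=> // t lt; apply: hl; exact: le_trans lt.
Qed.

(* Coarse paths need not be continuous: the limit is taken pointwise, by
   Tychonoff's theorem. *)
Lemma lipschitz_path_limit X a b l : compact X -> 0 <= l ->
  (forall e, 0 < e -> exists g, coarse_path X a b l e g) ->
  exists g, [/\ forall t, X (g t), g 0 = a, g l = b &
    forall t t', enorm (g t - g t') <= `|t - t'|].
Proof.
move=> cX l0 coarse.
have inv0 (n : nat) : (0 : R) < n.+1%:R^-1 by rewrite invr_gt0 ltr0n.
have [gs gsP] := choice (fun n : nat => coarse n.+1%:R^-1 (inv0 n)).
have cXR : compact [set h : {ptws R -> 'rV[R]_m} | forall t, X (h t)].
  exact: (@tychonoff R (fun=> 'rV[R]_m) (fun=> X)).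
have [|g [/= Xg clg]] := cXR (gs @ \oo) _.
  by exists 0%N => // n _; case: (gsP n).
(* A cluster point for pointwise convergence is approached at two times simultaneously, which is
   what a Lipschitz inequality involves. *)
have near_gs t t' k N : 0 < k -> exists n, [/\ (N <= n)%N,
    enorm (g t - gs n t) < k & enorm (g t' - gs n t') < k].
  move=> k0.
  have nb u : \forall h \near (g : {ptws R -> 'rV[R]_m}), enorm (g u - h u) < k.
    have : \forall x \near (g u), enorm (g u - x) < k.
      have := @enormB_continuous R m (g u) (g u).
      move/(@cvgrPdist_lt _ _ _ (nbhs (g u)) (nbhs_filter (g u))) => /(_ _ k0).
      apply: filterS => x; rewrite subrr enorm0 sub0r normrN enormB.
      by rewrite ger0_norm ?enorm_ge0.
    exact: (@proj_continuous R (fun=> 'rV[R]_m) u g).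
  have gsN : (gs @ \oo) [set gs n | n in [set n | (N <= n)%N]].
    by exists N => // n /= Nn; exists n.
  have nb2 : \forall h \near (g : {ptws R -> 'rV[R]_m}),
      enorm (g t - h t) < k /\ enorm (g t' - h t') < k.
    exact: (@filterI _ _ (nbhs_filter (g : {ptws R -> 'rV[R]_m})) _ _ (nb t) (nb t')).
  have [_ [[n Nn <-] [h1 h2]]] := clg _ _ gsN nb2.
  by exists n.
have inv_le k : 0 < k -> exists N, forall n, (N <= n)%N -> n.+1%:R^-1 < k :> R.
  move=> k0; have [N _ hN] := near_infty_natSinv_lt (PosNum k0).
  by exists N => n /hN.
have Lip t t' : t <= t' -> enorm (g t - g t') <= t' - t.
  move=> tt'; rewrite leNgt; apply/negP => h.
  (* A third of the excess for each error: the approximation at [t], the one at [t'], and the jump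
     size [1 / (n + 1)]. *)
  pose k := (enorm (g t - g t') - (t' - t)) / 3.
  have k0 : 0 < k by rewrite /k; lra.
  have k3 : 3 * k = enorm (g t - g t') - (t' - t) by rewrite /k; field.
  clearbody k; have [N hN] := inv_le k k0; have [n [Nn h1 h2]] := near_gs t t' k N k0.
  have [_ _ _ /(_ t t' tt')] := gsP n; have := hN n Nn.
  have := ler_enormB (gs n t) (g t) (g t'); have := ler_enormB (gs n t') (gs n t) (g t').
  by rewrite (enormB (gs n t') (g t')); move: (n.+1%:R^-1) => x; lra.
have eqg t x : (forall n, gs n t = x) -> g t = x.
  move=> h; apply/eqP; rewrite -subr_eq0; apply/eqP/enorm_eq0/eqP.
  rewrite eq_le enorm_ge0 andbT leNgt; apply/negP => k0.
  by have [n []] := near_gs t t _ 0%N k0; rewrite h ltxx.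
exists g; split=> //.
- apply: eqg => n; have [_ _ /(_ 0 (lexx 0)) h _] := gsP n.
  apply/eqP; rewrite -subr_eq0; apply/eqP/enorm_eq0/eqP.
  by rewrite eq_le h enorm_ge0.
- by apply: eqg => n; have [_ /(_ l (lexx l))] := gsP n.
- move=> t t'; have [tt'|/ltW tt'] := leP t t'.
    by rewrite distrC ger0_norm ?subr_ge0 //; exact: Lip.
  by rewrite enormB ger0_norm ?subr_ge0 //; exact: Lip.
Qed.

(** Reparametrize [g] affinely from [t] to [t'] over [0, 1]; the bounds on the terms of a polygonal
    sum telescope to [|t - t'|]. *)
Lemma intrinsic_dist_lipschitz X g : (forall t, X (g t)) ->
  (forall t t', enorm (g t - g t') <= `|t - t'|) ->
  forall t t', (intrinsic_dist X (g t) (g t') <= `|t - t'|%:E)%E.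
Proof.
move=> Xg gL t t'; pose h u := g (t + u * (t' - t)).
have hL u v : enorm (h u - h v) <= `|t - t'| * `|u - v|.
  apply: (le_trans (gL _ _)).
  have -> : t + u * (t' - t) - (t + v * (t' - t)) = (t - t') * (v - u) by ring.
  by rewrite normrM (distrC v).
apply: (@le_trans _ _ (path_length h)).
  apply: ereal_inf_lbound; exists h => //; split.
  - apply: continuous_subspaceT => x; apply: enorm_lipschitz_continuous => e e0.
    have e1 : 0 < e / (`|t - t'| + 1) by rewrite divr_gt0 // ltr_wpDl.
    have : \forall y \near x, `|x - y| <= e / (`|t - t'| + 1).
      by apply/nbhs_normP; exists (e / (`|t - t'| + 1)) => // y /ltW.
    apply: filterS => y; rewrite ler_pdivlMr ?ltr_wpDl // => xy.
    by apply: (le_trans (hL x y)); have := normr_ge0 (x - y); nra.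
  - by rewrite /h mul0r addr0.
  - by rewrite /h mul1r addrC subrK.
  - by move=> u _; exact: Xg.
apply: ge_ereal_sup => _ [s [ps /eqP ls] <-]; rewrite lee_fin /polygonal_sum.
set z := nth 1 (0 :: s).
have zS i : (i < size s)%N -> z i <= z i.+1.
  by move=> si; apply/ltW/(pathP 1 ps).
apply: (@le_trans _ _ (\sum_(0 <= i < size s) `|t - t'| * (z i.+1 - z i))).
  rewrite big_nat [leRHS]big_nat; apply: ler_sum => i /andP[_ si].
  by apply: (le_trans (hL _ _)); rewrite [X in _ * X <= _]ger0_norm // subr_ge0; exact: zS.
rewrite -mulr_sumr telescope_sumr //.
have -> : z (size s) = 1 by rewrite -[RHS]ls (last_nth 1).
by rewrite /z /= subr0 mulr1.
Qed.

End LipschitzPaths.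

(** * Paths in sets of positive reach *)

Section ReachPaths.
Context {R : realType} {m : nat}.
Implicit Types (X : set 'rV[R]_m) (a b p : 'rV[R]_m) (tau : \bar R).

Lemma reach_eta_ge0 tau d : 0 < d -> (d%:E < tau)%E -> 0 <= reach_eta tau d.
Proof.
case: tau => [t| |] //= d0; last by move=> _; lra.
rewrite lte_fin => dt; rewrite mulr_ge0 ?asin_ge0 //; first lra.
by rewrite divr_ge0 /= ?ler_pdivrMr; lra.
Qed.

Lemma reach_eta_le tau d : 0 < d -> ((2 * d)%:E < tau)%E ->
  reach_eta tau d <= 2 * pi / 3 * d.
Proof.
case: tau => [t| |] //= d0; last by move=> _; have := @pi_ge3 R; nra.
rewrite lte_fin => dt; have t0 : 0 < t by lra.
have : asin (d / t) <= pi / 3 * (d / t).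
  by apply: asin_le_chord; rewrite ?divr_ge0 ?ltr_pdivrMr //; lra.
move=> h; apply: (@le_trans _ _ (2 * t * (pi / 3 * (d / t)))).
  by rewrite ler_pM2l //; lra.
by rewrite le_eqVlt; apply/orP; left; apply/eqP; field; lra.
Qed.

Lemma lipschitz_path_of_midpoints X (L : 'rV[R]_m -> 'rV[R]_m -> R) D lam a b :
  compact X ->
  (forall a b, X a -> X b -> enorm (a - b) <= D -> enorm (a - b) <= L a b) ->
  0 <= lam -> lam < 1 ->
  (forall a b, X a -> X b -> enorm (a - b) <= D -> exists p, [/\ X p,
    L a p + L p b <= L a b, enorm (a - p) <= lam * enorm (a - b) &
    enorm (p - b) <= lam * enorm (a - b)]) ->
  X a -> X b -> enorm (a - b) <= D ->
  exists g, [/\ forall t, X (g t), g 0 = a, g (L a b) = b &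
    forall t t', enorm (g t - g t') <= `|t - t'|].
Proof.
move=> cX Lge lam0 lam1 mid Xa Xb ab; apply: lipschitz_path_limit => //.
  exact: le_trans (enorm_ge0 _) (Lge _ _ Xa Xb ab).
by move=> e e0; apply: (coarse_path_exists Lge lam0 lam1 mid).
Qed.

(** For infinite reach the sagitta bound holds for every large [t], which forces the sagitta to
    vanish. *)
Lemma midpoint_mem X a b : compact X -> (forall t, unique_nearest X t) ->
  X a -> X b -> X (midpoint a b).
Proof.
move=> cX uX Xa Xb.
have [p np] := nearest_exists (midpoint a b) cX (ex_intro _ a Xa).
suff s0 : enorm (midpoint a b - p) = 0.
  by move/enorm_eq0/eqP: s0; rewrite subr_eq0 => /eqP ->; exact: np.1.
apply/eqP; rewrite eq_le enorm_ge0 andbT leNgt; apply/negP => s0.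
set s := enorm _ in s0; set u := enorm (a - b) / 2.
have u0 : 0 <= u by rewrite /u divr_ge0 ?enorm_ge0.
(* Large enough that [2 t s > u^2 + s^2]; the summand [u] ensures [u < t]. *)
pose t := (u ^+ 2 + s ^+ 2) / s + u + 1.
have us0 : 0 <= (u ^+ 2 + s ^+ 2) / s.
  by rewrite divr_ge0 ?(ltW s0) // addr_ge0 ?sqr_ge0.
have ut : u < t by rewrite /t; lra.
have [_] := midpoint_sagitta cX (uX t) Xa Xb np ut; rewrite -/s -/u.
have e : (u ^+ 2 + s ^+ 2) / s * s = u ^+ 2 + s ^+ 2 by rewrite divfK // gt_eqF.
have -> : 2 * t * s = 2 * (u ^+ 2 + s ^+ 2) + 2 * u * s + 2 * s.
  by rewrite -e /t; ring.
have := sqr_ge0 u; have := sqr_ge0 s; have := mulr_ge0 u0 (ltW s0); lra.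
Qed.

Lemma reach_path X d a b : compact X ->
  0 < d -> (d%:E < reach X)%E -> X a -> X b -> enorm (a - b) <= 2 * d ->
  exists g l, [/\ 0 <= l <= reach_eta (reach X) d, forall t, X (g t),
    g 0 = a, g l = b & forall t t', enorm (g t - g t') <= `|t - t'|].
Proof.
move=> cX d0; case: (reach X) (@unique_nearest_reach _ _ X) => [t| |] //= uX.
  rewrite lte_fin => dt Xa Xb ab; have t0 : 0 < t by lra.
  (* The length of the circular arc of radius [t] over the chord [x y]. For infinite reach, the
     chord itself takes this role. *)
  pose L (x y : 'rV[R]_m) : R := 2 * t * asin (enorm (x - y) / (2 * t)).
  have Lge x y : X x -> X y -> enorm (x - y) <= 2 * d -> enorm (x - y) <= L x y.
    move=> _ _ xy.
    have : enorm (x - y) / (2 * t) <= asin (enorm (x - y) / (2 * t)).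
      apply: id_le_asin; rewrite divr_ge0 ?enorm_ge0 /= ?ler_pdivrMr; lra.
    by rewrite ler_pdivrMr ?(mulrC (asin _)) //; lra.
  have dt1 : d / t < 1 by rewrite ltr_pdivrMr; lra.
  have dt0 : 0 <= d / t by rewrite divr_ge0; lra.
  have [|||g [Xg g0 gl gL]] := lipschitz_path_of_midpoints (L := L)
    (lam := (1 + d / t) / 2) cX Lge _ _ _ Xa Xb ab; [lra|lra| |].
    by move=> x y Xx Xy xy; apply: (midpoint_asin cX (uX t _)).
  exists g, (L a b); split=> //; apply/andP; split.
    exact: le_trans (enorm_ge0 _) (Lge _ _ Xa Xb ab).
  rewrite ler_pM2l; last lra.
  have h : enorm (a - b) / (2 * t) <= d / t.
    by rewrite ler_pdivrMr; [have -> : d / t * (2 * t) = 2 * d by field; lra|lra].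
  have h0 : 0 <= enorm (a - b) / (2 * t) by rewrite divr_ge0 ?enorm_ge0; lra.
  by apply: le_asin => //; rewrite in_itv /=; lra.
move=> _ Xa Xb ab.
have [||x y Xx Xy _|g [Xg g0 gl gL]] := lipschitz_path_of_midpoints
  (L := fun x y : 'rV[R]_m => enorm (x - y)) (lam := 2^-1) (D := 2 * d)
  cX (fun _ _ _ _ _ => lexx _) _ _ _ Xa Xb ab.
- lra.
- lra.
- exists (midpoint x y); rewrite (enormB x (midpoint x y)) midpointBl midpointBr.
  rewrite enormN !enorm_half (enormB y x); split; [|lra|lra|lra].
  by apply: midpoint_mem => // t; apply: uX; rewrite leey.
- by exists g, (enorm (a - b)); split=> //; rewrite enorm_ge0.
Qed.

End ReachPaths.

(** * Paths, thickenings and interleavings *)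

Section PathLemmas.
Context {R : realType}.

Lemma path_joined_map (T U : topologicalType) (h : T -> U) (A : set T) (B : set U) x y :
  continuous h -> (forall z, A z -> B (h z)) ->
  @path_joined R T A x y -> @path_joined R U B (h x) (h y).
Proof.
move=> ch AB [g [cg <- <- gA]]; exists (h \o g); split=> //.
  apply/continuousP => O oO; move/continuousP: cg => /(_ (h @^-1` O)); apply.
  by move/continuousP: ch; apply.
by move=> t /gA /AB.
Qed.

(** [O] and [K] have the same preimage in [0, 1]; it is open and closed there, and [0, 1] is
    connected. *)
Lemma path_clopen (T : topologicalType) (g : R -> T) (O K : set T) :
  {within `[0, 1], continuous g} -> open O -> closed K ->
  (forall t, t \in `[0, 1] -> O (g t) <-> K (g t)) -> O (g 0) -> O (g 1).
Proof.
move=> cg oO cK OK O0.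
have i0 : `[0, 1]%classic (0 : R) by rewrite /= in_itv /= lexx ler01.
have i1 : `[0, 1]%classic (1 : R) by rewrite /= in_itv /= lexx ler01.
have /open_subspaceP[V oV VE] : open (g @^-1` O : set (subspace `[0, 1])).
  by move/continuousP: cg; apply.
have /closed_subspaceP[W cW WE] : closed (g @^-1` K : set (subspace `[0, 1])).
  by move/continuous_closedP: cg; apply.
have e : `[0, 1] `&` V = `[0, 1] `&` W.
  rewrite setIC VE [RHS]setIC WE; apply/seteqP; split=> t [Ogt t1]; split=> //.
    by move: Ogt; rewrite /= OK.
  by rewrite /= OK.
have : (`[0, 1] `&` V) 1.
  rewrite (@segment_connected R 0 1 (`[0, 1] `&` V)) //; [|by exists V|by exists W].
  by exists 0; rewrite setIC VE.
by rewrite setIC VE => -[].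
Qed.

(** The times with an admissible vertex related to [u] and those with an unrelated one form two
    closed sets, as [V] is finite. They cover [0, 1] and are disjoint, so the second is empty. *)
Lemma closed_cover_joined (T : topologicalType) (V : finType) (C : V -> set T)
    (E : V -> V -> Prop) (g : R -> T) :
  (forall u v w, E u v -> E v w -> E u w) ->
  (forall v, closed (C v)) -> {within `[0, 1], continuous g} ->
  (forall t, t \in `[0, 1] -> exists v, C v (g t)) ->
  (forall t u v, t \in `[0, 1] -> C u (g t) -> C v (g t) -> E u v) ->
  forall u v, C u (g 0) -> C v (g 1) -> E u v.
Proof.
move=> Etrans cC cg cover meet u v C0 C1.
pose K (P : set V) := \bigcup_(w in P) C w.
have cK P : closed (K P).
  by apply: closed_bigcup => [|w _]; [exact: finite_finset|exact: cC].
have sep t : t \in `[0, 1] -> (~` K [set w | ~ E u w]) (g t) <-> K (E u) (g t).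
  move=> t1; split=> [nK|[w Euw Cw] [w' nE Cw']].
    have [w Cw] := cover t t1; exists w => //.
    by apply: contrapT => nE; apply: nK; exists w.
  by apply: nE; apply: Etrans Euw _; exact: meet Cw Cw'.
have i0 : 0 \in `[(0 : R), 1] by rewrite in_itv /= lexx ler01.
have i1 : 1 \in `[(0 : R), 1] by rewrite in_itv /= lexx ler01.
have := path_clopen cg (closed_openC (cK _)) (cK (E u)) sep.
(* Reflexivity at [u] comes from [meet] at time 0 with [u] taken twice. *)
rewrite !sep // => /(_ (ex_intro2 _ _ u (meet 0 u u i0 C0 C0) C0)) [w Euw Cw].
by apply: Etrans Euw _; exact: meet Cw C1.
Qed.

End PathLemmas.

Section Thickening.
Context {R : realType}.
Implicit Types (I : oint R) (eps : {nonneg R}).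

Lemma thicken_dist eps I (s t : R) :
  oint_set I s -> `|t - s| <= eps%:num -> oint_set (thicken eps I) t.
Proof.
rewrite ler_distl => -[ls sh] /andP[t1 t2]; split => /=.
  by rewrite EFinN lteBlDr //; apply: (lt_le_trans ls); rewrite lee_fin; lra.
by rewrite -lteBlDr //; apply: le_lt_trans sh; rewrite lee_fin; lra.
Qed.

Lemma oint_convex I (s t u : R) :
  oint_set I s -> oint_set I t -> 0 <= u <= 1 -> oint_set I ((1 - u) * s + u * t).
Proof.
move=> [ls sh] [lt th] /andP[u0 u1]; wlog st : s t u ls sh lt th u0 u1 / s <= t.
  move=> h; have [/h|/ltW ts] := leP s t; first exact.
  have -> : (1 - u) * s + u * t = (1 - (1 - u)) * t + (1 - u) * s by ring.
  by apply: h => //; lra.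
split; [apply: (lt_le_trans ls)|apply: le_lt_trans th]; rewrite lee_fin; nra.
Qed.

End Thickening.

Section Interleaving.
Context {R : realType} (eps : {nonneg R}).

Section ShiftMap.
Variables (Y Z : rspace R) (p : Y -> Z).
Hypothesis p_joined : forall I y y',
  @path_joined R Y (@preimage_oint R Y I) y y' ->
  @path_joined R Z (@preimage_oint R Z (thicken eps I)) (p y) (p y').

Lemma shift_map_mem I (y : Y) :
  @preimage_oint R Y I y -> @preimage_oint R Z (thicken eps I) (p y).
Proof.
by move=> Iy; have [] := path_joined_mem (p_joined (@path_joined_refl R Y _ _ Iy)).
Qed.

Definition shift_point I (y : @preimage_oint R Y I) :
    @preimage_oint R Z (thicken eps I) :=
  SigSub (mem_set (shift_map_mem (set_valP y))).

(** The map that [p] induces on path components; [p_joined] takes the place of continuity in making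
    it independent of the representative. *)
Definition shift_map I (c : pi0_cosheaf Y I) : Defs.shift eps (pi0_cosheaf Z) I :=
  pi0_class R (shift_point (pi0_repr c)).

Lemma shift_map_class I (y : @preimage_oint R Y I) :
  shift_map (pi0_class R y : pi0_cosheaf Y I) = pi0_class R (shift_point y).
Proof.
apply/pi0_classP; apply: p_joined.
by apply/(pi0_classP R (pi0_repr (pi0_class R y)) y); rewrite pi0_reprK.
Qed.

Lemma shift_map_natural : natural shift_map.
Proof.
move=> I J IJ c; rewrite /= shift_map_class [shift_map c]/shift_map.
rewrite pi0_incl_class; apply/pi0_classP; apply: path_joined_refl.
exact: set_valP.
Qed.

End ShiftMap.

Lemma interleaved_of_maps (Y Z : rspace R) (p : Y -> Z) (q : Z -> Y) :
  (forall I y y', @path_joined R Y (@preimage_oint R Y I) y y' ->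
    @path_joined R Z (@preimage_oint R Z (thicken eps I)) (p y) (p y')) ->
  (forall I z z', @path_joined R Z (@preimage_oint R Z I) z z' ->
    @path_joined R Y (@preimage_oint R Y (thicken eps I)) (q z) (q z')) ->
  (forall I y, @preimage_oint R Y I y -> @path_joined R Y
    (@preimage_oint R Y (thicken eps (thicken eps I))) (q (p y)) y) ->
  (forall I z, @preimage_oint R Z I z -> @path_joined R Z
    (@preimage_oint R Z (thicken eps (thicken eps I))) (p (q z)) z) ->
  interleaved eps (pi0_cosheaf Y) (pi0_cosheaf Z).
Proof.
move=> pJ qJ qp pq; exists (@shift_map Y Z p pJ), (@shift_map Z Y q qJ).
split; [exact: shift_map_natural|exact: shift_map_natural| |].
  move=> I c; rewrite /= [shift_map _ c]/shift_map shift_map_class.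
  by apply/pi0_classP/qp; exact: set_valP.
move=> I c; rewrite /= [shift_map _ c]/shift_map shift_map_class.
by apply/pi0_classP/pq; exact: set_valP.
Qed.

End Interleaving.

(** * Reeb graphs *)

Section ReebLift.
Context {R : realType} (Y : rspace R).
Local Open Scope quotient_scope.

Definition reeb_pi (y : Y) : reeb_space Y := \pi_(reeb_space Y) y.

Definition reeb_repr (c : reeb_space Y) : Y := repr (c : {eq_quot (reeb_equiv Y)}).

Lemma reeb_reprK c : reeb_pi (reeb_repr c) = c.
Proof. exact: reprK. Qed.

Lemma reeb_pi_continuous : continuous reeb_pi.
Proof. exact: pi_continuous. Qed.

Lemma reeb_repr_joined y : @path_joined R Y (@height R Y @^-1` [set height y])
  y (reeb_repr (reeb_pi y)).
Proof.
have /eqmodP/asboolP // : y = reeb_repr (reeb_pi y) %[mod {eq_quot (reeb_equiv Y)}].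
by rewrite reprK.
Qed.

Lemma reeb_height_pi y : reeb_height (reeb_pi y) = height y.
Proof. by have [_] := path_joined_mem (reeb_repr_joined y). Qed.

Hypothesis lpc : forall (U : set Y) y, open U -> U y ->
  \forall z \near y, @path_joined R Y U y z.

(* Path components of an open preimage are open and saturated, so their images
   in the Reeb space are open. *)
Lemma reeb_lift I (c c' : reeb_space Y) :
  @path_joined R (reeb_graph Y) (@preimage_oint R (reeb_graph Y) I) c c' ->
  @path_joined R Y (@preimage_oint R Y I) (reeb_repr c) (reeb_repr c').
Proof.
case=> g [cg g0 g1 gI]; pose J := @path_joined R Y (@preimage_oint R Y I).
have oI : open (@preimage_oint R Y I).
  move/continuousP: (@height_continuous R Y); apply.
  by apply: openI; [exact: open_ereal_gt|exact: open_ereal_lt].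
have repr_pi y : @preimage_oint R Y I y -> J y (reeb_repr (reeb_pi y)).
  move=> Iy; apply: path_joinedS (reeb_repr_joined y).
  by move=> z /= ez; rewrite /preimage_oint /= ez.
(* [P] and [Q] split the part of the Reeb space over [I] into the component of [c] and the rest,
   read off on representatives. *)
pose P := [set x | preimage_oint I (reeb_repr x) /\ J (reeb_repr c) (reeb_repr x)].
pose Q := [set x | preimage_oint I (reeb_repr x) /\ ~ J (reeb_repr c) (reeb_repr x)].
have near_comp y : @preimage_oint R Y I y -> \forall z \near y,
    preimage_oint I (reeb_repr (reeb_pi z)) /\
    J (reeb_repr (reeb_pi y)) (reeb_repr (reeb_pi z)).
  move=> Iy; apply: filterS (lpc oI Iy) => z yz.
  have [_ Iz] := path_joined_mem yz.
  have [_ Irz] := path_joined_mem (repr_pi z Iz).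
  split=> //; apply: path_joined_trans (path_joined_sym (repr_pi y Iy)) _.
  exact: path_joined_trans yz (repr_pi z Iz).
have pre_pi y : preimage_oint I (reeb_repr (reeb_pi y)) -> preimage_oint I y.
  by rewrite /preimage_oint /= -[height (reeb_repr _)]/(reeb_height _) reeb_height_pi.
have oP : open (P : set (reeb_space Y)).
  (* Openness in the quotient topology is by definition openness of the preimage. *)
  suff : open (reeb_pi @^-1` P) by [].
  rewrite openE => y [/pre_pi Iy Jy]; apply: filterS (near_comp y Iy) => z [Iz yz].
  by split=> //; exact: path_joined_trans Jy yz.
have oQ : open (Q : set (reeb_space Y)).
  suff : open (reeb_pi @^-1` Q) by [].
  rewrite openE => y [/pre_pi Iy Jy]; apply: filterS (near_comp y Iy) => z [Iz yz].
  by split=> // Jz; apply: Jy; exact: path_joined_trans Jz (path_joined_sym yz).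
have sep t : t \in `[0, 1] -> P (g t) <-> (~` Q) (g t).
  move=> /gI It; split=> [[_ Jt] [_ nJt]|nQ]; first exact: nJt.
  by split=> //; apply: contrapT => nJ; exact: nQ.
have := path_clopen cg oP (open_closedC oQ) sep; rewrite g0 g1.
have Ic : preimage_oint I (reeb_repr c).
  by have := gI 0; rewrite in_itv /= lexx ler01 g0; apply.
by case=> //; split=> //; exact: path_joined_refl.
Qed.

End ReebLift.

(** * Geometric realizations of graphs *)

Section Realization.
Context {R : realType} (V : finType) (e : rel V) (h : V -> R).
Hypothesis e_sym : symmetric e.
Local Notation real := (@realization R V e).
Local Notation pl := (pl_space e h).

Definition on_edge (u v : V) (z : {ptws V -> R}) : Prop :=
  forall w, z w != 0 -> w = u \/ w = v.

Lemma realizationP (z : real) : [/\ forall v, 0 <= \val z v, \sum_v \val z v = 1 &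
  exists u v, (u = v \/ e u v) /\ on_edge u v (\val z)].
Proof. exact: (set_valP z). Qed.

Lemma sum_on_edge u v (z : {ptws V -> R}) (F : V -> R) : on_edge u v z -> u != v ->
  \sum_w z w * F w = z u * F u + z v * F v.
Proof.
move=> zuv uv; rewrite (bigD1 u) // (bigD1 v) /=; last by rewrite eq_sym.
rewrite big1 ?addr0 // => w /andP[wu wv].
have [->|/zuv[] ew] := eqVneq (z w) 0; first by rewrite mul0r.
  by rewrite ew eqxx in wu.
by rewrite ew eqxx in wv.
Qed.

Lemma realization_other u (z : real) : \val z u != 0 ->
  exists v, (u = v \/ e u v) /\ on_edge u v (\val z).
Proof.
have [_ _ [a [b [ab zab]]]] := realizationP z => /[dup] zu /zab[->|->].
  by exists b.
exists a; split; last by move=> w /zab[]; [right|left].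
by case: ab => [->|ab]; [left|right; rewrite e_sym].
Qed.

Lemma realization_height u v (z : real) : on_edge u v (\val z) -> u != v ->
  0 <= \val z v <= 1 /\ height (z : pl) = (1 - \val z v) * h u + \val z v * h v.
Proof.
move=> zuv uv; have [z0 z1 _] := realizationP z.
have : \sum_w \val z w * 1 = 1 by rewrite -mulr_suml z1 mulr1.
rewrite (sum_on_edge _ zuv uv) !mulr1 => zz.
split; first by have := z0 u; have := z0 v; lra.
by rewrite /= /affine_extension (sum_on_edge _ zuv uv) -zz addrK.
Qed.

Lemma realization_height_vertex u (z : real) : on_edge u u (\val z) ->
  height (z : pl) = h u /\ \val z u = 1.
Proof.
move=> zu; have [_ z1 _] := realizationP z.
have E (F : V -> R) : \sum_w \val z w * F w = \val z u * F u.
  rewrite (bigD1 u) //= big1 ?addr0 // => w wu.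
  have [->|/zu[] ew] := eqVneq (\val z w) 0; first by rewrite mul0r.
    by rewrite ew eqxx in wu.
  by rewrite ew eqxx in wu.
have zu1 : \val z u = 1.
  by rewrite -[RHS]z1 -[LHS]mulr1 -(E (fun=> 1)); apply: eq_bigr => w _; rewrite mulr1.
by split=> //; rewrite /= /affine_extension E zu1 mul1r.
Qed.

(** At most two coordinates are nonzero, and they sum to 1. *)
Lemma realization_big (z : real) : exists v, 2^-1 <= \val z v.
Proof.
have [z0 z1 [u [v [uv zuv]]]] := realizationP z.
have [euv|nuv] := eqVneq u v.
  subst v; exists u; rewrite (realization_height_vertex zuv).2.
  by rewrite invf_le1 ?ltr0n // ler1n.
have := @realization_height _ _ z zuv nuv.
have : \sum_w \val z w * 1 = 1 by rewrite -mulr_suml z1 mulr1.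
rewrite (sum_on_edge _ zuv nuv) !mulr1 => zz _.
by have [?|?] := leP 2^-1 (\val z u); [exists u|exists v; lra].
Qed.

Lemma vertex_mem (v : V) : @realization R V e (fun w => (w == v)%:R).
Proof.
split=> [w||]; first exact: ler0n.
  rewrite (bigD1 v) //= eqxx big1 ?addr0 // => w /negbTE ->.
  by [].
exists v, v; split; first by left.
by move=> w; case: (eqVneq w v) => [->|_]; [left|rewrite eqxx].
Qed.

Definition vertex (v : V) : real := SigSub (mem_set (vertex_mem v)).

Lemma on_edge_vertexl u v : on_edge u v (\val (vertex u)).
Proof. by move=> w /=; case: (eqVneq w u) => [->|_]; [left|rewrite eqxx]. Qed.

Lemma on_edge_vertexr u v : on_edge u v (\val (vertex v)).
Proof. by move=> w /=; case: (eqVneq w v) => [->|_]; [right|rewrite eqxx]. Qed.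

Lemma vertex_height v : height (vertex v : pl) = h v.
Proof. by have [] := @realization_height_vertex v (vertex v) (@on_edge_vertexl v v). Qed.

Lemma vertex_preimage I v : oint_set I (h v) -> preimage_oint I (vertex v : pl).
Proof. by rewrite -vertex_height. Qed.

(** The straight segment stays on the edge; the height is affine along it and [I] is convex. *)
Lemma realization_segment I u v (z z' : pl) : u = v \/ e u v ->
  on_edge u v (\val z) -> on_edge u v (\val z') ->
  preimage_oint I z -> preimage_oint I z' ->
  @path_joined R pl (@preimage_oint R pl I) z z'.
Proof.
move=> uv zuv zuv' Iz Iz'.
pose c (t : R) : {ptws V -> R} := fun w => (1 - t) * \val z w + t * \val z' w.
have [z0 z1 _] := realizationP z; have [z0' z1' _] := realizationP z'.
have csum (F : V -> R) t : \sum_w c t w * F w =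
    (1 - t) * \sum_w \val z w * F w + t * \sum_w \val z' w * F w.
  rewrite !mulr_sumr -big_split; apply: eq_bigr => w _.
  by rewrite /c mulrDl !mulrA.
have cmem t : t \in `[0, 1] -> @realization R V e (c t).
  rewrite in_itv /= => /andP[t0 t1]; split.
  - by move=> w; rewrite addr_ge0 // mulr_ge0 ?z0 ?z0' ?subr_ge0.
  - have : \sum_w c t w * 1 = 1.
      by rewrite (csum (fun=> 1)) -!mulr_suml z1 z1'; ring.
    by rewrite -mulr_suml mulr1.
  - exists u, v; split=> // w; apply: contra_neqP.
    move=> nuv; rewrite /c.
    have [->|/zuv //] := eqVneq (\val z w) 0.
    by have [->|/zuv' //] := eqVneq (\val z' w) 0; rewrite !mulr0 addr0.
(* For [t] outside [0, 1] the combination may leave the realization; the default [z] is harmless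
   there. *)
pose g (t : R) : real := insubd z (c t).
have gE t : t \in `[0, 1] -> \val (g t) = c t.
  by move=> /cmem ct; rewrite val_insubd (mem_set ct).
have c_cont : continuous c.
  move=> t; apply/cvg_sup => w.
  apply: (@continuous_comp_initial {ptws V -> R} R R (fun x => x w) c) => x.
  apply: cvgD; apply: cvgM; try exact: cvg_cst; last exact: cvg_id.
  by apply: cvgB; [exact: cvg_cst|exact: cvg_id].
exists g; split.
- apply: continuous_comp_initial.
  apply: (@subspace_eq_continuous R `[0, 1] {ptws V -> R} c).
    by move=> t /set_mem t01; exact: esym (gE t t01).
  exact: continuous_subspaceT.
- apply: val_inj; rewrite gE ?in_itv /= ?lexx ?ler01 //.
  by apply: funext => w; rewrite /c subr0 mul1r mul0r addr0.
- apply: val_inj; rewrite gE ?in_itv /= ?lexx ?ler01 //.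
  by apply: funext => w; rewrite /c subrr mul1r mul0r add0r.
- move=> t t01; rewrite /preimage_oint /= /affine_extension gE // csum.
  by apply: oint_convex => //; move: t01; rewrite in_itv.
Qed.

End Realization.

(** * The interleaving *)

Section Estimator.
Context {R : realType} {m : nat} (X : set 'rV[R]_m) (S : {fset X}) (f : X -> R)
  (f_continuous : continuous f) (delta : R) (eps : {nonneg R}).
Local Notation Y := (RSpace f_continuous).
Local Notation e := (@neighborhood_graph R m X S delta).
Local Notation h := (fun s : S => f (\val s)).
Local Notation Z := (pl_space e h).

Hypothesis delta_ge0 : 0 <= delta.
Hypothesis cover : forall x : X, exists s : S, enorm (\val x - \val (\val s)) <= delta.
(** Closeness to both end values matters: it bounds the distance of [f z] to every value
    interpolated along the edge. *)
Hypothesis link : forall x y : X, enorm (\val x - \val y) <= 2 * delta ->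
  exists A : set X,
    (forall z, A z -> `|f z - f x| <= eps%:num /\ `|f z - f y| <= eps%:num)
    /\ @path_joined R X A x y.
Hypothesis lpc : forall (U : set X) y, open U -> U y ->
  \forall z \near y, @path_joined R X U y z.

Lemma neighborhood_graph_sym : symmetric e.
Proof. by move=> s s'; rewrite /neighborhood_graph eq_sym enormB. Qed.

Lemma link_endpoints x y : enorm (\val x - \val y) <= 2 * delta ->
  `|f y - f x| <= eps%:num.
Proof. by move=> /link[A [Af xy]]; have [_ /Af[]] := path_joined_mem xy. Qed.

Lemma near_sample (I : oint R) (x : X) (s : S) : oint_set I (f x) ->
  enorm (\val x - \val (\val s)) <= delta -> oint_set (thicken eps I) (f (\val s)).
Proof.
move=> Ix xs; apply: (thicken_dist Ix); apply: link_endpoints.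
by apply: (le_trans xs); have := delta_ge0; lra.
Qed.

(** Cover the path by the closed balls of radius [delta] around the samples: two samples near the
    same point are equal or adjacent, and the edge between them lies over the thickened interval. *)
Lemma sample_joined (I : oint R) (x x' : X) (s s' : S) :
  @path_joined R Y (@preimage_oint R Y I) x x' ->
  enorm (\val x - \val (\val s)) <= delta ->
  enorm (\val x' - \val (\val s')) <= delta ->
  @path_joined R Z (@preimage_oint R Z (thicken eps I))
    (@vertex R _ e s) (@vertex R _ e s').
Proof.
case=> g [cg g0 g1 gI] xs xs'.
pose C (s : S) := [set x : X | enorm (\val x - \val (\val s)) <= delta].
apply: (@closed_cover_joined R X S C (fun s s' : S => @path_joined R Z
  (@preimage_oint R Z (thicken eps I)) (@vertex R _ e s) (@vertex R _ e s')) g) => //.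
- by move=> u v w; exact: path_joined_trans.
- move=> u; rewrite /C.
  apply: (@closed_comp _ _ (fun x : X => enorm (\val x - \val (\val u)))
    [set r | r <= delta]).
    move=> x1 _; apply: (@continuous_comp X 'rV[R]_m R val
      (fun w => enorm (w - \val (\val u)))).
      exact: initial_continuous.
    exact: enormB_continuous.
  exact: closed_le.
- by move=> t _; exact: cover.
- move=> t u v t01 Cu Cv; have := gI t t01.
  rewrite /preimage_oint /= => It.
  have Iu := near_sample It Cu; have Iv := near_sample It Cv.
  apply: (@realization_segment _ _ _ _ _ u v).
  + have [->|uv] := eqVneq u v; [by left|right].
    rewrite /neighborhood_graph uv /=.
    have := ler_enormB (\val (g t)) (\val (\val u)) (\val (\val v)).
    by move: Cu Cv; rewrite /C /= (enormB _ (\val (\val u))); lra.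
  + exact: on_edge_vertexl.
  + exact: on_edge_vertexr.
  + exact: vertex_preimage.
  + exact: vertex_preimage.
- by rewrite /C g0.
- by rewrite /C g1.
Qed.

Lemma edge_enorm u v : e u v -> enorm (\val (\val u) - \val (\val v)) <= 2 * delta.
Proof. by case/andP. Qed.

Lemma big_vertex_near (I : oint R) (z : Z) (v : S) : 2^-1 <= \val z v ->
  @preimage_oint R Z I z -> oint_set (thicken eps I) (f (\val v)).
Proof.
move=> zv Iz; apply: (thicken_dist Iz).
have [|w [vw zvw]] := realization_other neighborhood_graph_sym (z := z) (u := v).
  by rewrite gt_eqF // (lt_le_trans _ zv) // invr_gt0.
have [evw|nvw] := eqVneq v w.
  by subst w; rewrite (realization_height_vertex h zvw).1 subrr normr0.
have {}vw : e v w by case: vw => // vw; rewrite vw eqxx in nvw.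
have [/andP[z0 z1] ->] := realization_height h zvw nvw.
have := link_endpoints (edge_enorm vw).
have -> : f (\val v) - ((1 - \val z w) * f (\val v) + \val z w * f (\val w)) =
  \val z w * - (f (\val w) - f (\val v)) by ring.
rewrite normrM normrN (ger0_norm z0); have := normr_ge0 (f (\val w) - f (\val v)).
nra.
Qed.

(** Two distinct vertices of weight at least 1/2 at one point are the ends of its edge. The path
    given by [link] stays over the thickened interval, since the height of the point is a convex
    combination of the end values. *)
Lemma big_vertex_joined (I : oint R) (z z' : Z) (v v' : S) :
  @path_joined R Z (@preimage_oint R Z I) z z' ->
  2^-1 <= \val z v -> 2^-1 <= \val z' v' ->
  @path_joined R Y (@preimage_oint R Y (thicken eps I)) (\val v) (\val v').
Proof.
case=> g [cg g0 g1 gI] zv zv'.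
pose C (v : S) := [set z : Z | 2^-1 <= \val z v].
apply: (@closed_cover_joined R Z S C (fun v v' : S => @path_joined R Y
  (@preimage_oint R Y (thicken eps I)) (\val v) (\val v')) g) => //.
- by move=> u w w'; exact: path_joined_trans.
- move=> u; rewrite /C.
  apply: (@closed_comp _ _ (fun z : Z => \val z u) [set r | 2^-1 <= r]).
    move=> x1 _; apply: (@continuous_comp Z {ptws S -> R} R val (fun k => k u)).
      exact: initial_continuous.
    exact: (@proj_continuous S (fun=> R) u).
  exact: closed_ge.
- by move=> t _; exact: realization_big.
- move=> t u w t01 Cu Cw; have := gI t t01; move: Cu Cw.
  move: (g t) => y Cu Cw Iy; rewrite /C /= in Cu Cw.
  have [->|uw] := eqVneq u w.
    by apply: path_joined_refl; exact: (big_vertex_near Cw Iy).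
  have [|w' [uw' yuw]] := realization_other neighborhood_graph_sym (z := y) (u := u).
    by rewrite gt_eqF // (lt_le_trans _ Cu) // invr_gt0.
  have ew : w = w'.
    have [|wu|//] := yuw w; first by rewrite gt_eqF // (lt_le_trans _ Cw) // invr_gt0.
    by rewrite wu eqxx in uw.
  subst w'.
  have {}uw' : e u w by case: uw' => // uw'; rewrite uw' eqxx in uw.
  have [/andP[y0 y1] yh] := realization_height h yuw uw.
  have [A [Af Auw]] := link (edge_enorm uw').
  apply: path_joinedS Auw => x /Af[xu xw].
  apply: (thicken_dist Iy); rewrite yh.
  have -> : f x - ((1 - \val y w) * f (\val u) + \val y w * f (\val w)) =
    (1 - \val y w) * (f x - f (\val u)) + \val y w * (f x - f (\val w)) by ring.
  have y1' : 0 <= 1 - \val y w by lra.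
  apply: (le_trans (ler_normD _ _)).
  rewrite !normrM (ger0_norm y0) (ger0_norm y1'); nra.
- by rewrite /C g0.
- by rewrite /C g1.
Qed.

Lemma reeb_estimator_interleaved :
  interleaved eps (pi0_cosheaf (reeb_graph Y)) (pl_reeb_estimator S f delta).
Proof.
have [s sP] := choice cover.
have [b bP] := choice (@realization_big R S e h).
pose p (c : reeb_graph Y) : Z := @vertex R _ e (s (reeb_repr c)).
pose q (z : Z) : reeb_graph Y := @reeb_pi R Y (\val (b z)).
have pi_mem J x : @preimage_oint R Y J x ->
    @preimage_oint R (reeb_graph Y) J (@reeb_pi R Y x).
  by move=> Jx; have := reeb_height_pi x; rewrite /preimage_oint /preimage /= => ->.
have piJ J x y : @path_joined R Y (@preimage_oint R Y J) x y ->
    @path_joined R (reeb_graph Y) (@preimage_oint R (reeb_graph Y) J)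
      (@reeb_pi R Y x) (@reeb_pi R Y y).
  by apply: path_joined_map; [exact: reeb_pi_continuous|exact: pi_mem].
apply: (@interleaved_of_maps R eps (reeb_graph Y) Z p q).
- move=> I c c' cc'; exact: (sample_joined (@reeb_lift R Y lpc _ _ _ cc')).
- by move=> I z z' zz'; apply: piJ; exact: (big_vertex_joined zz').
- move=> I c Ic; rewrite -[X in path_joined _ _ X](reeb_reprK c).
  (* At a vertex of the graph the only weight of at least 1/2 is its own. *)
  have -> : q (p c) = @reeb_pi R Y (\val (s (reeb_repr c))).
    have := bP (p c); rewrite /q /p /=; case: eqVneq => [-> //|_].
    by rewrite leNgt invr_gt0 ltr0n.
  apply: (path_joinedS (preimage_subset (sub_thicken eps _))).
  apply: piJ; apply: path_joined_sym.
  have [|A [Af xs]] := @link (reeb_repr c) (\val (s (reeb_repr c))).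
    by apply: (le_trans (sP _)); have := delta_ge0; lra.
  by apply: path_joinedS xs => y /Af[yx _]; apply: (thicken_dist Ic).
- move=> I z Iz; set v := b z.
  have Iv := big_vertex_near (bP z) Iz.
  (* First from the sample chosen for the class of [v] to [v], which is a sample at distance 0 from
     itself; then along the edge from [v] to [z]. *)
  apply: (path_joined_trans (y := @vertex R _ e v : Z)).
    have vx := @reeb_repr_joined R Y (\val v).
    apply: (@sample_joined _ (reeb_repr (q z)) (\val v)) => //; last first.
      by rewrite subrr enorm0.
    apply: path_joinedS (path_joined_sym vx) => y /= fy.
    by rewrite /preimage_oint /= fy.
  apply: (path_joinedS (preimage_subset (sub_thicken eps _))).
  have [|w [vw zvw]] := realization_other neighborhood_graph_sym (z := z) (u := v).
    by rewrite gt_eqF // (lt_le_trans _ (bP z)) // invr_gt0.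
  apply: (@realization_segment _ _ _ _ _ v w) => //.
  + exact: on_edge_vertexl.
  + exact: vertex_preimage.
  + by apply: sub_thicken.
Qed.

End Estimator.

(** * Consequences of positive reach for the topology of [X], and the distance bound *)

Section ReachTopology.
Context {R : realType} {m : nat} (X : set 'rV[R]_m).

Lemma intrinsic_dist_ge0 x y : (0 <= intrinsic_dist X x y)%E.
Proof.
apply: le_ereal_inf_tmp => _ [g _ <-].
apply: (@le_trans _ _ (polygonal_sum g [:: 1])%:E).
  by rewrite lee_fin; apply: sumr_ge0 => i _; exact: enorm_ge0.
by apply: ereal_sup_ubound; exists [:: 1] => //; exact: itv_partition1.
Qed.

(** The intrinsic bound controls the variation of [f]; the Euclidean one keeps short paths inside a
    given neighborhood. *)
Definition close_to (r : R) (x z : X) : Prop :=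
  (intrinsic_dist X (\val z) (\val x) <= r%:E)%E /\ enorm (\val z - \val x) <= r.

Lemma reach_joined d (x y : X) : compact X -> 0 < d -> (d%:E < reach X)%E ->
  enorm (\val x - \val y) <= 2 * d ->
  @path_joined R X [set z | close_to (reach_eta (reach X) d) x z /\
    close_to (reach_eta (reach X) d) y z] x y.
Proof.
move=> cX d0 dX xy.
have [g [l [/andP[l0 leta] Xg g0 gl gL]]] :=
  reach_path cX d0 dX (set_valP x) (set_valP y) xy.
(* Time is rescaled from [0, l] to [0, 1]; every time in between is within [l] of both ends, so the
   Lipschitz bounds apply to each. *)
pose G u : X := SigSub (mem_set (Xg (l * u))).
exists G; split.
- apply: continuous_subspaceT; apply: continuous_comp_initial => u.
  apply: enorm_lipschitz_continuous => r r0.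
  have r1 : 0 < r / (l + 1) by rewrite divr_gt0 // ltr_wpDl.
  have : \forall v \near u, `|u - v| <= r / (l + 1).
    by apply/nbhs_normP; exists (r / (l + 1)) => // v /ltW.
  apply: filterS => v; rewrite ler_pdivlMr ?ltr_wpDl // => uv.
  apply: (le_trans (gL _ _)); rewrite -mulrBr normrM (ger0_norm l0).
  by have := normr_ge0 (u - v); nra.
- by apply: val_inj; rewrite /= mulr0.
- by apply: val_inj; rewrite /= mulr1.
- move=> u; rewrite in_itv /= => /andP[u0 u1].
  have h1 : `|l * u - 0| <= reach_eta (reach X) d.
    by rewrite subr0 ger0_norm ?mulr_ge0 //; nra.
  have h2 : `|l * u - l| <= reach_eta (reach X) d.
    by rewrite distrC ger0_norm; nra.
  have close v : `|l * u - v| <= reach_eta (reach X) d ->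
      (intrinsic_dist X (g (l * u)%R) (g v) <= (reach_eta (reach X) d)%:E)%E /\
      enorm (g (l * u) - g v) <= reach_eta (reach X) d.
    move=> luv; split; last exact: le_trans (gL _ _) luv.
    by apply: (le_trans (intrinsic_dist_lipschitz Xg gL _ _)); rewrite lee_fin.
  by rewrite /close_to /= -g0 -gl; split; exact: close.
Qed.

Lemma reach_locally_path_connected d (U : set X) y : compact X ->
  0 < d -> (d%:E < reach X)%E -> open U -> U y ->
  \forall z \near y, @path_joined R X U y z.
Proof.
move=> cX d0 dX [W oW <-] Wy.
have /nbhs_normP[r /= r0 rW] : nbhs (\val y) W by exact: open_nbhs_nbhs.
have pi0 := @pi_gt0 R.
(* The bound [d / 2] gives [2 d' < reach X], so that [reach_eta_le] applies; the bound [r / pi] then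
   keeps the path within [2 r / 3 < r] of [y]. *)
pose d' := Num.min (d / 2) (r / pi).
have d'0 : 0 < d' by rewrite lt_min !divr_gt0.
have d'd : d' <= d / 2 by rewrite ge_min lexx.
have d'r : d' * pi <= r by rewrite -ler_pdivlMr // ge_min lexx orbT.
have d'X : ((2 * d')%:E < reach X)%E by apply: le_lt_trans dX; rewrite lee_fin; lra.
have d'X1 : (d'%:E < reach X)%E by apply: le_lt_trans dX; rewrite lee_fin; lra.
have : \forall z \near y, enorm (\val z - \val y) < 2 * d'.
  have : \forall w \near (\val y), enorm (w - \val y) < 2 * d'.
    have /(@cvgrPdist_lt _ _ _ (nbhs (\val y)) (nbhs_filter (\val y))) :=
      @enormB_continuous R m (\val y) (\val y).
    have d2 : 0 < 2 * d' by rewrite mulr_gt0.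
    move=> /(_ _ d2); apply: filterS => w.
    by rewrite subrr enorm0 sub0r normrN ger0_norm ?enorm_ge0.
  exact: (@initial_continuous _ _ (\val : X -> 'rV[R]_m) y).
apply: filterS => z zy.
have yz : enorm (\val y - \val z) <= 2 * d' by rewrite enormB ltW.
apply: path_joinedS (reach_joined cX d'0 d'X1 yz) => w [[_ wy] _] /=.
apply: rW => /=; apply: (le_lt_trans (norm_le_enorm _)); rewrite enormB.
apply: (le_lt_trans wy); apply: (le_lt_trans (reach_eta_le d'0 d'X)).
have -> : 2 * pi / 3 * d' = 2 / 3 * (d' * pi) by field.
lra.
Qed.

(** Common form of both bounds: [eps] will be the modulus at [reach_eta], or [2 * pi / 3 * d] for a
    1-Lipschitz [f]. *)
Lemma estimator_dist_le (S : {fset X}) (f : X -> R) (f_continuous : continuous f)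
    (d eps : R) : compact X -> 0 < d -> (d%:E < reach X)%E -> 0 <= eps ->
  (forall x : X, exists2 s : X, s \in S & enorm (\val x - \val s) <= d) ->
  (forall x z : X,
    (intrinsic_dist X (\val z) (\val x) <= (reach_eta (reach X) d)%:E)%E ->
    `|f z - f x| <= eps) ->
  (interleaving_dist (pi0_cosheaf (reeb_graph (RSpace f_continuous)))
     (pl_reeb_estimator S f d) <= eps%:E)%E.
Proof.
move=> cX d0 dX eps0 cover feps.
apply: ereal_inf_lbound; exists (NngNum eps0) => //=.
apply: reeb_estimator_interleaved.
- exact: ltW.
- by move=> x; have [s sS xs] := cover x; exists [` sS]%fset.
- move=> x y xy; eexists; split; last exact: reach_joined cX d0 dX xy.
  by move=> z [[zx _] [zy _]]; split; exact: feps.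
- by move=> U y; exact: reach_locally_path_connected cX d0 dX.
Qed.

End ReachTopology.

Theorem theorem4p2 (R : realType) (m : nat) (X : set 'rV[R]_m) (S : {fset X})
    (f : X -> R) (f_continuous : continuous f) (omega : R -> R)
    (tau : \bar R) (delta : R) :
  compact X ->
  (forall x y : X, (intrinsic_dist X (\val x) (\val y) < +oo)%E) ->
  constructible (RSpace f_continuous) ->
  modulus_of_continuity f omega ->
  tau = reach X -> (0 < tau)%E ->
  0 < delta -> (delta%:E < tau)%E ->
  (forall x : X, exists2 s : X, s \in S & enorm (\val x - \val s) <= delta) ->
  (interleaving_dist (pi0_cosheaf (reeb_graph (RSpace f_continuous)))
     (pl_reeb_estimator S f delta) <= (omega (reach_eta tau delta))%:E)%E /\
  ((forall x y : X,
      (`|f x - f y|%:E <= intrinsic_dist X (\val x) (\val y))%E) ->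
   ((2 * delta)%:E < tau)%E ->
   (interleaving_dist (pi0_cosheaf (reeb_graph (RSpace f_continuous)))
      (pl_reeb_estimator S f delta) <= (2 * pi / 3 * delta)%:E)%E).
Proof.
move=> cX finX _ [omega0 omega_le f_omega] -> _ delta0 deltaX cover.
have eta0 := reach_eta_ge0 delta0 deltaX.
split=> [|f_lip deltaX2].
  apply: estimator_dist_le => // [|x z zx].
    by rewrite -omega0 omega_le.
  (* Finiteness of the intrinsic distance turns the bound in the extended reals into one on its
     [fine] value. *)
  apply: (le_trans (f_omega z x)); apply: omega_le.
    exact/fine_ge0/intrinsic_dist_ge0.
  by rewrite -lee_fin fineK // ge0_fin_numE ?finX // intrinsic_dist_ge0.
apply: estimator_dist_le => // [|x z zx].
  exact: le_trans eta0 (reach_eta_le delta0 deltaX2).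
rewrite -lee_fin; apply: (le_trans (f_lip z x)); apply: (le_trans zx).
by rewrite lee_fin reach_eta_le.
Qed.
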